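(* Assume $\mathrm{MA}(\sigma\text{-centered})$. Then there is a sequence of P-points $\langle \mathcal{U}_{[a]} : [a]\in \mathcal{P}(\omega)/\mathrm{FIN}\rangle$ (ultrafilters on $\omega$ indexed by the elements of $\mathcal{P}(\omega)/\mathrm{FIN}$) such that: (1) if $a\subseteq^* b$, then $\mathcal{U}_{[a]}\leq_{RK}\mathcal{U}_{[b]}$; (2) if $b\not\subseteq^* a$, then $\mathcal{U}_{[b]}\not\leq_{T}\mathcal{U}_{[a]}$.
   Context: All ultrafilters are on $\omega$ and non-principal. $a\subseteq^* b$ means $a\setminus b$ is finite. $\mathrm{FIN}$ is the ideal of finite subsets of $\omega$, $\mathcal{P}(\omega)/\mathrm{FIN}$ the quotient Boolean algebra, and $[a]$ the equivalence class of $a\subseteq\omega$ (so $[a]=[a']$ iff $a\setminus a'$ and $a'\setminus a$ are finite). An ultrafilter $\mathcal{U}$ is a P-point if for every $f:\omega\to\omega$ there is $A\in\mathcal{U}$ on which $f$ is finite-to-one or constant. For ultrafilters $\mathcal{U},\mathcal{V}$ on $\omega$, $\mathcal{U}\leq_{RK}\mathcal{V}$ (Rudin–Keisler) means there is $f:\omega\to\omega$ with $a\in\mathcal{U}\iff f^{-1}(a)\in\mathcal{V}$ for all $a\subseteq\omega$. $\mathcal{U}\leq_T\mathcal{V}$ (Tukey) means there is a convergent map $g:\langle\mathcal{V},\supseteq\rangle\to\langle\mathcal{U},\supseteq\rangle$, i.e. one mapping cofinal subsets to cofinal subsets; equivalently there is $\phi:\mathcal{V}\to\mathcal{U}$ which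 is monotone ($a\subseteq b\Rightarrow\phi(a)\subseteq\phi(b)$) and cofinal in $\mathcal{U}$ ($\forall b\in\mathcal{U}\,\exists a\in\mathcal{V}\ \phi(a)\subseteq b$). $\mathrm{MA}(\sigma\text{-centered})$: for every poset $\mathbb{P}$ that is a countable union of centered sets (sets any finitely many of whose elements have a common lower bound) and every family of fewer than $\mathfrak{c}=2^{\aleph_0}$ dense subsets of $\mathbb{P}$, there is a filter on $\mathbb{P}$ meeting each of them. *)

(* Defs.v *)
From mathcomp Require Import all_boot all_order.
From mathcomp Require Import generic_quotient.
From mathcomp Require Import boolp classical_sets functions cardinality filter.

Set Implicit Arguments.
Unset Strict Implicit.
Unset Printing Implicit Defensive.

Import Order.TTheory.

Local Open Scope classical_set_scope.
Local Open Scope card_scope.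
Local Open Scope quotient_scope.

Definition almost_subset (a b : set nat) : Prop := finite_set (a `\` b).

Notation "A `<=* B" := (almost_subset A B)
  (at level 70, no associativity) : classical_set_scope.

Lemma almost_subset_refl a : a `<=* a.
Proof. by rewrite /almost_subset setDv; exact: finite_set0. Qed.

Lemma almost_subset_trans a b c : a `<=* b -> b `<=* c -> a `<=* c.
Proof.
move=> ab bc; apply: (@sub_finite_set _ _ ((a `\` b) `|` (b `\` c))).
  by move=> n [an cn]; have [bn|bn] := pselect (b n); [right|left].
by rewrite finite_setU.
Qed.

Definition eq_mod_fin (a b : set nat) : bool := `[< a `<=* b /\ b `<=* a >].

Lemma eq_mod_fin_equiv : equiv_class_of eq_mod_fin.
Proof.
split=> [a|a b|b a c].
- by apply/asboolP; split; exact: almost_subset_refl.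
- by apply: asbool_equiv_eq; split=> -[].
- move=> /asboolP[ab ba] /asboolP[bc cb].
  by apply/asboolP; split; [exact: almost_subset_trans bc|exact: almost_subset_trans ba].
Qed.

Canonical eq_mod_fin_equivRel := EquivRelPack eq_mod_fin_equiv.

(* The underlying set of P(omega)/FIN; [a] is \pi_pomega_mod_fin a. *)
Definition pomega_mod_fin := {eq_quot eq_mod_fin}.

Definition nonprincipal_ultrafilter (U : set_system nat) : Prop :=
  UltraFilter U /\ forall n, U <> principal_filter n.

Definition P_point (U : set_system nat) : Prop :=
  nonprincipal_ultrafilter U /\
  forall f : nat -> nat, exists2 A, U A &
    (forall n, finite_set (A `&` f @^-1` [set n])) \/
    (exists c, forall x, A x -> f x = c).

Definition RK_le (U V : set_system nat) : Prop :=
  exists f : nat -> nat, forall a, U a <-> V (f @^-1` a).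

(* Cofinality in the directed order <F, superset>. *)
Definition cofinal_in (F X : set_system nat) : Prop :=
  X `<=` F /\ forall b, F b -> exists2 a, X a & a `<=` b.

(* g is a map from V to U; its values outside V are irrelevant. *)
Definition Tukey_le (U V : set_system nat) : Prop :=
  exists g : set nat -> set nat,
    (forall a, V a -> U (g a)) /\
    forall X, cofinal_in V X -> cofinal_in U (g @` X).

Section Forcing.
Context {d : Order.disp_t} {T : porderType d}.
Local Open Scope order_scope.

Definition centered (C : set T) : Prop :=
  forall F : set T, finite_set F -> F `<=` C ->
    exists p, forall q, F q -> p <= q.

Definition order_dense (D : set T) : Prop :=
  forall p, exists2 q, D q & q <= p.

Definition order_filter (G : set T) : Prop :=
  [/\ G !=set0,
      forall p q, G p -> p <= q -> G q
    & forall p q, G p -> G q -> exists r, [/\ G r, r <= p & r <= q]].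

End Forcing.

(* Nonemptiness of the poset is needed: filters are nonempty, while the empty
   poset is vacuously sigma-centered. *)
Definition MA_sigma_centered : Prop :=
  forall (d : Order.disp_t) (T : porderType d), [set: T] !=set0 ->
  forall C : nat -> set T, \bigcup_n C n = [set: T] ->
    (forall n, centered (C n)) ->
  forall DD : set (set T),
    DD #<= [set: set nat] -> DD #!= [set: set nat] ->
    (forall D, DD D -> order_dense D) ->
  exists2 G : set T, order_filter G & forall D, DD D -> G `&` D !=set0.

(* Main.v *)
Require Import Defs.
From HB Require Import structures.
From mathcomp Require Import all_boot all_order generic_quotient.
From mathcomp Require Import boolp classical_sets functions cardinality filter.
From mathcomp Require wochoice.
From mathcomp Require Import zify.

(* The ultrafilters are the images [f_a(U)] of one ultrafilter [U] under maps
   [f_a : nat -> nat], one for each class of index sets [a]; [U] and the [f_a] are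
   built together by transfinite recursion over continuum many tasks.  A stage
   is a set of fewer than continuum many triples (set in [U], index set [a], map
   [f_a]), and the induction hypothesis [good] is finitary: for any finitely many
   of these triples, the intersection of their sets contains injective images of
   arbitrarily large cubes [k^J], [J] a finite set of coordinates, on which each
   [f_a] is equivalent to the restriction of points of [k^J] to [J] meet [a].
   Goodness thus survives unions of chains.

   MA(sigma-centered) provides, for a good stage, a sequence of such cubes that is
   eventually compatible with every finite part of the stage.  The union of such a
   sequence is a pseudo-intersection of the sets chosen so far (hence P-points),
   and a new index set [c] can be added by letting [f_c] read off the coordinates
   in [c]; this gives the Rudin-Keisler reductions.  The product Ramsey theorem
   makes [U] an ultrafilter.

   On a P-point a monotone cofinal map is governed by a relation [R] between
   finite sets and points.  If [b] is not almost contained in [a], every large cube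
   has a coordinate in [b] outside [a]; thinning out the values of that single
   coordinate removes, for each finite set [s] of [f_a]-values, a point of [R s]
   from the [f_b]-image while keeping the [f_a]-image. *)

Set Implicit Arguments.
Unset Strict Implicit.
Unset Printing Implicit Defensive.

Local Open Scope classical_set_scope.
Local Open Scope card_scope.
Local Open Scope quotient_scope.

(** * Cardinals below the continuum *)

Lemma card_le_inj T U (A : set T) (B : set U) (f : T -> U) :
  (forall x, A x -> B (f x)) ->
  (forall x y, A x -> A y -> f x = f y -> x = y) -> A #<= B.
Proof.
move=> fAB fI; suff /unsquash g : $|{injfun A >-> B}| by exact: inj_card_le g.
apply/injfunPex; exists f => // x y /set_mem Ax /set_mem Ay; exact: fI.
Qed.

Lemma card_le_injP T (U : pointedType) (A : set T) (B : set U) : A #<= B ->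
  exists f : T -> U, (forall x, A x -> B (f x)) /\
    (forall x y, A x -> A y -> f x = f y -> x = y).
Proof.
move=> /pcard_leP/injfunPex[f fAB fI]; exists f; split=> // x y Ax Ay.
by apply: fI; exact/mem_set.
Qed.

Lemma cantor_set_nat : ~ ([set: set nat] #<= [set: nat]).
Proof.
move=> /card_le_injP[f [_ fI]].
pose D : set nat := [set n | exists2 X, f X = n & ~ X n].
have [DD|nDD] := pselect (D (f D)).
  by case: (DD) => X /fI XD; rewrite XD // in DD *; apply.
by apply: (nDD); exists D.
Qed.

Lemma card_le_setU T (A B : set T) :
  A #<= [set: set nat] -> B #<= [set: set nat] -> A `|` B #<= [set: set nat].
Proof.
move=> /card_le_injP[f [_ fI]] /card_le_injP[g [_ gI]].
pose h x : set nat := fun n => if n is m.+1 then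
  (A x /\ f x m) \/ (~ A x /\ g x m) else A x.
apply: (@card_le_inj _ _ _ _ h) => // x y ABx ABy hxy.
have AE : A x = A y := congr1 (fun X : set nat => X 0) hxy.
have hE m : h x m.+1 = h y m.+1 := congr1 (fun X : set nat => X m.+1) hxy.
have [Ax|nAx] := pselect (A x).
  have Ay : A y by rewrite -AE.
  apply: fI => //; apply/funext => m; apply/propext.
  have := hE m; rewrite /h => /= e.
  split=> fm.
    have : (A x /\ f x m) \/ (~ A x /\ g x m) by left.
    by rewrite e => -[[]|[]].
  have : (A y /\ f y m) \/ (~ A y /\ g y m) by left.
  by rewrite -e => -[[]|[]].
have nAy : ~ A y by rewrite -AE.
have Bx : B x by case: ABx.
have By : B y by case: ABy.
apply: gI => //; apply/funext => m; apply/propext.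
have := hE m; rewrite /h => /= e.
split=> fm.
  have : (A x /\ f x m) \/ (~ A x /\ g x m) by right.
  by rewrite e => -[[]|[]].
have : (A y /\ f y m) \/ (~ A y /\ g y m) by right.
by rewrite -e => -[[]|[]].
Qed.

Definition small T (A : set T) :=
  A #<= [set: set nat] /\ ~ ([set: set nat] #<= A).

Lemma small_le T U (A : set T) (B : set U) : A #<= B -> small B -> small A.
Proof.
move=> AB [Bc cB]; split; first exact: card_le_trans Bc.
by move=> cA; apply: cB; exact: card_le_trans AB.
Qed.

Lemma small_image T U (f : T -> U) (A : set T) : small A -> small (f @` A).
Proof. exact: small_le (card_image_le _ _). Qed.

Lemma small_nat : small [set: nat].
Proof.
split; last exact: cantor_set_nat.
apply: (@card_le_inj _ _ _ _ (fun n : nat => [set n])) => // x y _ _ e.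
by have : [set y] x by rewrite -e.
Qed.

Lemma small1 T (x : T) : small [set x].
Proof.
apply: (small_le _ small_nat); apply: (@card_le_inj _ _ _ _ (fun=> 0)) => //.
by move=> y z -> ->.
Qed.

(* Koenig-style: [set nat] is equipotent with its square, so it is not the union
   of two sets of smaller cardinality. *)
Lemma small_setU T (A B : set T) : small A -> small B -> small (A `|` B).
Proof.
move=> [Ac cA] [Bc cB]; split; first exact: card_le_setU.
elim/Ppointed: T => T in A B Ac cA Bc cB *.
  by move=> h; apply: cA; rewrite (empty_eq0 A) -(empty_eq0 (A `|` B)).
move=> /card_le_injP[f [fAB fI]].
pose pr (X Y : set nat) : set nat := [set n | X n./2 /\ odd n \/ Y n./2 /\ ~~ odd n].
have pr1 X Y n : pr X Y n.*2.+1 = X n.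
  apply/propext; rewrite /pr /= uphalf_double odd_double /=.
  by split=> [[[]|[]]|]//; left.
have pr2 X Y n : pr X Y n.*2 = Y n.
  apply/propext; rewrite /pr /= doubleK odd_double /=.
  by split=> [[[]|[]]|]//; right.
have prI X Y X' Y' : pr X Y = pr X' Y' -> X = X' /\ Y = Y'.
  move=> e; split; apply/funext => n.
    by rewrite -(pr1 X Y) e pr1.
  by rewrite -(pr2 X Y) e pr2.
(* Either one row [pr X] is sent entirely into [A], or every row has a point sent into [B]; in both
   cases one of the two sets receives continuum many points. *)
have [[X hX]|nX] := pselect (exists X, forall Y, A (f (pr X Y))).
  apply: cA; apply: (@card_le_inj _ _ _ _ (fun Y => f (pr X Y))) => // Y Y' _ _.
  by move=> /fI => /(_ I I)/prI[].
have /choice[g gP] : forall X, exists Y, B (f (pr X Y)).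
  move=> X; apply: contrapT => h; apply: nX; exists X => Y.
  by case: (fAB (pr X Y) I) => // ?; case: h; exists Y.
apply: cB; apply: (@card_le_inj _ _ _ _ (fun X => f (pr X (g X)))) => // X X' _ _.
by move=> /fI => /(_ I I)/prI[].
Qed.

(** If some initial segment is as large as [W], take the least [w] with such a segment and pull the
    order back along an injection of [W] into it: a segment of the new order embeds in a segment
    below a point less than [w]. *)
Lemma small_well_order (W : Type) :
  exists lt : W -> W -> Prop,
  [/\ well_founded lt, (forall x y, [\/ lt x y, x = y | lt y x]),
      (forall x y z, lt x y -> lt y z -> lt x z) &
      forall w, ~ ([set: W] #<= [set v | lt v w])].
Proof.
have [R Rwo] := wochoice.well_ordering_principle {classic W}.
have Rmin (P : set W) : P !=set0 -> exists m, P m /\ forall x, P x -> R m x.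
  move=> [x Px].
  have [|m [[/asboolP Pm mP] _]] := Rwo (fun x => `[< P x >]).
    by exists x; apply/asboolP.
  by exists m; split=> // y Py; apply: mP; apply/asboolP.
have Rtot x y : R x y \/ R y x.
  have [|m [[]->]h] := Rmin [set x; y]; first by exists x; left.
    by left; apply: h; right.
  by right; apply: h; left.
have Ranti x y : R x y -> R y x -> x = y.
  move=> xy yx.
  (* Both [x] and [y] are least in this pair, and least elements are unique. *)
  have [|m [_ mu]] := Rwo (fun z => `[< z = x \/ z = y >]).
    by exists x; apply/asboolP; left.
  have Rr z : R z z by case: (Rtot z z).
  rewrite -(mu x); last first.
    by split; [apply/asboolP; left|move=> z /asboolP[]->].
  rewrite -(mu y)//.
  by split; [apply/asboolP; right|move=> z /asboolP[]->].
pose lt0 x y := R x y /\ x <> y.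
have lt0min (P : set W) : P !=set0 -> exists m, P m /\ forall x, lt0 x m -> ~ P x.
  move=> /Rmin[m [Pm mP]]; exists m; split=> // x [xm xNm] Px.
  by apply: xNm; apply: Ranti => //; exact: mP.
have lt0tot x y : [\/ lt0 x y, x = y | lt0 y x].
  have [->|xy] := pselect (x = y); first by constructor 2.
  by case: (Rtot x y) => h; [constructor 1|constructor 3]; split=> // /esym.
have lt0trans x y z : lt0 x y -> lt0 y z -> lt0 x z.
  move=> [xy nxy] [yz nyz]; split; last first.
    by move=> e; subst z; apply: nxy; exact: Ranti.
  have [|m [hm mP]] := Rmin [set t | [\/ t = x, t = y | t = z]].
    by exists x; constructor 1.
  case: hm => e; subst m; first by apply: mP; constructor 3.
    by case: nxy; apply: Ranti => //; apply: mP; constructor 1.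
  by case: nyz; apply: Ranti => //; apply: mP; constructor 2.
have wf0 : well_founded lt0.
  move=> x; apply: contrapT => nx.
  have [|m [mA mP]] := lt0min [set y | ~ Acc lt0 y]; first by exists x.
  by apply: mA; constructor => y /mP/contrapT.
have [nbig|/existsNP[w0 /contrapT w0big]] :=
    pselect (forall w, ~ ([set: W] #<= [set v | lt0 v w])).
  by exists lt0.
have [|w [wbig wmin]] := lt0min [set w | [set: W] #<= [set v | lt0 v w]].
  by exists w0.
pose PW := HB.pack_for pointedType {classic W} (isPointed.Build {classic W} (w0 : {classic W})).
have /card_le_injP[i [iw iI]] : [set: W] #<= ([set v | lt0 v w] : set PW) by [].
pose lt x y := lt0 (i x) (i y).
exists lt; split.
- move=> x; have [n ex] : exists n, n = i x by exists (i x).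
  elim: {n}(wf0 n) x ex => n _ IH x ex; constructor => y yx.
  by apply: (IH (i y)) => //; rewrite ex.
- move=> x y; case: (lt0tot (i x) (i y)) => h; [by constructor 1| |by constructor 3].
  by constructor 2; exact: iI.
- by move=> x y z; exact: lt0trans.
- move=> v h; apply: (wmin (i v)); first exact: iw.
  apply: card_le_trans h _; apply: (@card_le_inj _ _ _ _ i) => //.
  by move=> x y _ _; exact: iI.
Qed.

(** * Martin's axiom for finite approximations *)

Lemma MA_rel (T : Type) (le : T -> T -> Prop) (x0 : T) (C : T -> nat)
    (DD : set (set T)) : MA_sigma_centered ->
  (forall x, le x x) -> (forall x y, le x y -> le y x -> x = y) ->
  (forall x y z, le x y -> le y z -> le x z) ->
  (forall n (F : set T), finite_set F -> (forall q, F q -> C q = n) ->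
    F !=set0 -> exists p, forall q, F q -> le p q) ->
  small DD -> (forall D, DD D -> forall p, exists2 q, D q & le q p) ->
  exists G : set T,
    (forall p q, G p -> G q -> exists r, [/\ G r, le r p & le r q]) /\
    (forall D, DD D -> exists p, G p /\ D p).
Proof.
move=> MA refl anti tran cent [DDc cDD] dense.
pose leb x y := `[< le x y >].
have r1 : reflexive leb by move=> x; apply/asboolP.
have r2 : antisymmetric leb.
  by move=> x y /andP[/asboolP ? /asboolP ?]; exact: anti.
have r3 : transitive leb.
  by move=> y x z /asboolP xy /asboolP yz; apply/asboolP; exact: tran yz.
pose d := Order.Disp tt tt.
pose Tc : choiceType := HB.pack_for choiceType T (gen_eqMixin T) (gen_choiceMixin T).
pose P := HB.pack_for (porderType d) Tc (Order.Le_isPOrder.Build d Tc r1 r2 r3).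
have leE (x y : P) : Order.le x y = `[< le x y >] by [].
have [||||||G [_ _ Gd] Gm] := MA d P _ (fun n => [set p : T | C p = n]) _ _ DD.
- by exists x0.
- by apply/seteqP; split=> // p _; exists (C p).
- move=> n F finF FC; have [F0|/set0P/negP/negPn/eqP->] := pselect (F !=set0).
    have [p pP] := cent n F finF FC F0.
    by exists p => q /pP h; rewrite leE; apply/asboolP.
  by exists x0.
- exact: DDc.
- apply/negP => h; apply: cDD; apply/card_leP.
  by move/card_esym/card_eqP : h => [f]; squash f.
- move=> D DDD p; have [q Dq qp] := dense _ DDD p; exists q => //.
  by rewrite leE; apply/asboolP.
exists G; split.
  move=> p q Gp Gq; have [r [Gr]] := Gd _ _ Gp Gq.
  by rewrite !leE => /asboolP rp /asboolP rq; exists r.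
by move=> D /Gm[p [Gp Dp]]; exists p.
Qed.

Section Fusion.
Variables (B : countType) (K : eqType) (S : set K).

(** A finite stem of the sequence under construction, with finitely many promises that all later
    terms have to respect. *)
Record fcond := FCond {
  stem : seq B; prom : set K; prom_fin : finite_set prom; prom_sub : prom `<=` S }.

Lemma fcondP p q : stem p = stem q -> prom p = prom q -> p = q.
Proof.
case: p q => [s F f i] [s' F' f' i'] /= e1 e2; subst s' F'.
by rewrite (Prop_irrelevance f f') (Prop_irrelevance i i').
Qed.

Variable (Q : seq K -> seq B -> B -> Prop) (b0 : B).

Definition fle (p q : fcond) :=
  [/\ prefix (stem q) (stem p), prom q `<=` prom p &
   forall n, size (stem q) <= n < size (stem p) ->
    forall L, (forall r, r \in L -> prom q r) ->
    Q L (take n (stem p)) (nth b0 (stem p) n)].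

Lemma take_prefix (s t : seq B) n : prefix s t -> n <= size s -> take n t = take n s.
Proof.
move=> /prefixP[u ->] h; rewrite take_cat; case: ltnP => // h'.
have -> : n = size s by lia.
by rewrite subnn take0 cats0 take_size.
Qed.

Lemma nth_prefix (s t : seq B) n : prefix s t -> n < size s -> nth b0 t n = nth b0 s n.
Proof. by move=> /prefixP[u ->] h; rewrite nth_cat h. Qed.

Lemma fle_trans p q r : fle p q -> fle q r -> fle p r.
Proof.
move=> [pq1 pq2 pq3] [qr1 qr2 qr3]; split.
- exact: prefix_trans pq1.
- exact: subset_trans pq2.
- move=> n nr L Lr; have [nq|nq] := ltnP n (size (stem q)).
    rewrite (take_prefix pq1) 1?ltnW// (nth_prefix pq1)//; apply: qr3 => //; lia.
  by apply: pq3 => [|x /Lr/qr2//]; lia.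
Qed.

(** Conditions with the same stem are bounded by the union of their promises, and there are
    countably many stems. The dense sets make every promise in [S] and every stem length occur. *)
Lemma fusion : MA_sigma_centered -> small S ->
  (forall L L' s b, {subset L <= L'} -> Q L' s b -> Q L s b) ->
  (forall L s, (forall r, r \in L -> S r) -> exists b, Q L s b) ->
  exists b : nat -> B, forall L, (forall r, r \in L -> S r) ->
    exists N, forall n, N <= n -> Q L (mkseq b n) (b n).
Proof.
move=> MA smS Qmon Qex.
have p0 : fcond.
  by apply: (@FCond [::] set0) => //; exact: finite_set0.
pose DS r := [set p | prom p r].
pose DN n := [set p | n <= size (stem p)].
have /(_ fle p0 (fun p => pickle (stem p)) ((DS @` S) `|` (DN @` [set: nat]))) := @MA_rel fcond.
case=> //.
- by move=> p; split=> //; [exact: prefix_refl|move=> n; lia].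
- move=> p q [pq1 pq2 _] [qp1 qp2 _]; apply: fcondP; last by apply/seteqP.
  have := size_prefix pq1; have := size_prefix qp1 => h1 h2.
  by move: pq1; rewrite prefixE => /eqP <-; rewrite take_oversize.
- exact: fle_trans.
- move=> n F finF FC [q0 Fq0].
  have finU : finite_set (\bigcup_(q in F) prom q).
    by apply: bigcup_finite => // q _; exact: prom_fin.
  have subU : \bigcup_(q in F) prom q `<=` S.
    by move=> r [q _]; exact: prom_sub.
  exists (@FCond (stem q0) _ finU subU) => q Fq.
  have e : stem q = stem q0 by apply: (pcan_inj pickleK); rewrite !FC.
  split=> /=; [by rewrite e prefix_refl|by move=> r qr; exists q|rewrite e => m; lia].
- by apply: small_setU; apply: small_image => //; exact: small_nat.
- move=> D [[r Sr <-]|[n _ <-]] p.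
    have fin : finite_set (prom p `|` [set r]).
      by rewrite finite_setU; split; [exact: prom_fin|exact: finite_set1].
    have sub : prom p `|` [set r] `<=` S.
      by move=> x [/prom_sub//|->].
    exists (@FCond (stem p) _ fin sub); first by right.
    by split=> /=; [exact: prefix_refl|by left|move=> m; lia].
  elim: n => [|n [q nq qp]].
    exists p => //; split=> //; [exact: prefix_refl|move=> m; lia].
  have [nq'|nq'] := ltnP n (size (stem q)); first by exists q.
  have [L LE] : exists L : seq K, forall r, r \in L <-> prom q r.
    have /finite_seqP[L LE] := prom_fin q.
    by exists L => r; rewrite LE.
  have [b Qb] : exists b, Q L (stem q) b.
    by apply: Qex => r /LE /prom_sub.
  exists (@FCond (rcons (stem q) b) _ (@prom_fin q) (@prom_sub q)).
    by rewrite /DN /= size_rcons; move: nq; rewrite /DN/=; lia.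
  apply: fle_trans qp; split=> //=; first exact: prefix_rcons.
  rewrite size_rcons => m /andP[m1 m2] L' L'q.
  have -> : m = size (stem q) by lia.
  rewrite -cats1 take_size_cat // nth_cat ltnn subnn /=.
  by apply: Qmon Qb => r /L'q /LE.
move=> G [Gd Gm].
have /choice[P PP] : forall n, exists p, G p /\ n < size (stem p).
  by move=> n; have [|p [Gp np]] := Gm (DN n.+1); [by right; exists n.+1|exists p].
(* Directedness of [G] makes the [n]-th term the same in all its conditions long enough to have
   one. *)
pose b n := nth b0 (stem (P n)) n.
have bE p n : G p -> n < size (stem p) -> nth b0 (stem p) n = b n.
  move=> Gp np; have [GP nP] := PP n; have [r [Gr [rp _ _] [rP _ _]]] := Gd _ _ Gp GP.
  by rewrite -(nth_prefix rp np) (nth_prefix rP nP).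
exists b => L LS.
have [p [Gp pL]] : exists p, G p /\ forall r, r \in L -> prom p r.
  elim: L LS => [|r L IH] LS; first by have [GP _] := PP 0; exists (P 0).
  have [x|p [Gp pL]] := IH; first by move=> xL; apply: LS; rewrite inE xL orbT.
  have [|q [Gq qr]] := Gm (DS r).
    by left; exists r => //; apply: LS; rewrite inE eqxx.
  have [t [Gt [_ tp _] [_ tq _]]] := Gd _ _ Gp Gq.
  exists t; split=> // x; rewrite inE => /orP[/eqP->|/pL/tp//]; exact: tq.
exists (size (stem p)) => n pn; have [GP nP] := PP n.
have [r [Gr [rp1 rp2 rp3] [rP _ _]]] := Gd _ _ Gp GP.
have nr : n < size (stem r) by apply: leq_trans nP (size_prefix rP).
have -> : mkseq b n = take n (stem r).
  apply: (@eq_from_nth _ b0); rewrite size_mkseq ?size_take ?nr// => i ni.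
  by rewrite nth_mkseq// nth_take// bE//; apply: ltn_trans nr.
by rewrite -(bE r)//; apply: rp3 => //; lia.
Qed.

End Fusion.

(** * Cubes and good stages *)

(* A set to be put into the ultrafilter, together with an index set [a] and the
   map [f_a]; [restr X] only asks for the set [X]. *)
Definition req := (set nat * set nat * (nat -> nat))%type.
Definition dom (r : req) := r.1.1.
Definition idx (r : req) := r.1.2.
Definition mp (r : req) := r.2.
Definition restr (X : set nat) : req := (X, setT, id).

Definition same (L : seq (set nat)) j j' := forall a, a \in L -> (a j <-> a j').
(* Coordinates whose [L]-type occurs only finitely often are discarded: this is
   what identifies index sets modulo finite sets. *)
Definition gcoord L j := forall M, exists2 j', M <= j' & same L j j'.
(** A list rich enough contains, type by type, a copy of any given list of coordinates satisfying
    [gcoord]; see [reindex]. *)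
Definition rich n L J :=
  forall j, gcoord L j -> n <= count (fun j' => `[< same L j j' >]) J.

Definition cube k (z : nat -> nat) := forall i, z i < k.
Definition agree (a : set nat) J (z z' : nat -> nat) :=
  forall i, i < size J -> a (nth 0 J i) -> z i = z' i.

(* [e] maps the cube of side [k] over the coordinates labelled by the list [J]
   into [nat]; points are total functions of which only the first [size J] values
   matter. *)
Definition brick1 (r : req) J k e := forall z, cube k z ->
  [/\ dom r (e z), k <= mp r (e z) &
   forall z', cube k z' -> (mp r (e z) = mp r (e z') <-> agree (idx r) J z z')].
Definition brick (F : seq req) J k e := forall r, r \in F -> brick1 r J k e.

Definition subreq (F : seq req) (S : set req) := forall r, r \in F -> S r.
Definition idxs (F : seq req) := [seq idx r | r <- F].

Definition good (S : set req) := forall F, subreq F S ->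
  forall J, (forall j, j \in J -> gcoord (idxs F) j) -> forall k, exists e, brick F J k e.

Definition addr (S : set req) (r : req) := S `|` [set r].

Lemma same_trans L i j k : same L i j -> same L j k -> same L i k.
Proof. by move=> h h' a aL; have := h a aL; have := h' a aL; tauto. Qed.

Lemma sub_same L L' j j' : {subset L' <= L} -> same L j j' -> same L' j j'.
Proof. by move=> LL h a /LL; exact: h. Qed.

Lemma sub_gcoord L L' j : {subset L' <= L} -> gcoord L j -> gcoord L' j.
Proof. by move=> LL h M; have [j' Mj sj] := h M; exists j' => //; exact: sub_same sj. Qed.

Lemma same_finite L : exists (T : finType) (tau : nat -> T),
  forall j j', tau j = tau j' <-> same L j j'.
Proof.
exists {ffun 'I_(size L) -> bool}, (fun j => [ffun i => `[< nth set0 L (i : 'I__) j >]]).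
move=> j j'; split=> [/ffunP e a aL|h].
  have ia : index a L < size L by rewrite index_mem.
  have := e (Ordinal ia); rewrite !ffunE /= nth_index// => e'.
  by split=> /asboolP h; apply/asboolP; [rewrite -e'|rewrite e'].
by apply/ffunP => i; rewrite !ffunE; apply: asbool_equiv_eq; apply: h; rewrite mem_nth.
Qed.

(** There are finitely many [L]-types; each recurs forever or stops at some bound, and the largest
    bound serves for all. *)
Lemma gcoord_cofinite L : exists M, forall j, M <= j -> gcoord L j.
Proof.
have [T [tau tauP]] := same_finite L.
have /choice[B BP] : forall v, exists M,
    (forall j, M <= j -> tau j <> v) \/ forall N, exists2 j, N <= j & tau j = v.
  move=> v; have [h|/existsNP[M h]] := pselect (forall N, exists2 j, N <= j & tau j = v).
    by exists 0; right.
  by exists M; left=> j Mj e; apply: h; exists j.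
exists (\max_v B v) => j jM N.
have [h|h] := BP (tau j).
  by case: (h j) => //; apply: leq_trans jM; exact: leq_bigmax.
by have [j' Nj' /esym/tauP] := h N; exists j'.
Qed.

Lemma rich_leq n n' L J : n <= n' -> rich n' L J -> rich n L J.
Proof. by move=> nn h j /h; exact: leq_trans. Qed.

(** A recurring [L']-type contains arbitrarily late coordinates, whose [L]-types recur too; the
    finer class is already large enough. *)
Lemma sub_rich n L L' J : {subset L' <= L} -> rich n L J -> rich n L' J.
Proof.
move=> LL h j gj; have [M MP] := gcoord_cofinite L.
have [j' Mj' jj'] := gj M.
apply: leq_trans (h _ (MP _ Mj')) _; apply: sub_count => x /asboolP sx.
by apply/asboolP; apply: same_trans jj' _; exact: sub_same sx.
Qed.

Lemma count_flatten_leq (T : eqType) (p : pred T) s ss :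
  s \in ss -> count p s <= count p (flatten ss).
Proof.
elim: ss => //= t ss IH; rewrite inE count_cat => /orP[/eqP->|/IH]; lia.
Qed.

Lemma exists_rich n L : exists J, (forall j, j \in J -> gcoord L j) /\ rich n L J.
Proof.
have [T [tau tauP]] := same_finite L.
have /choice[w wP] : forall v, exists j, (exists2 j', gcoord L j' & tau j' = v) ->
    gcoord L j /\ tau j = v.
  move=> v; have [[j gj <-]|h] := pselect (exists2 j', gcoord L j' & tau j' = v).
    by exists j.
  by exists 0.
pose ok v := `[< exists2 j', gcoord L j' & tau j' = v >].
exists (flatten [seq nseq n (w v) | v <- enum T & ok v]); split=> [j|j gj].
  move=> /flatten_mapP[v]; rewrite mem_filter => /andP[/asboolP/wP[gv _] _].
  by rewrite mem_nseq => /andP[_ /eqP->].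
have okj : ok (tau j) by apply/asboolP; exists j.
have [_ /esym/tauP sj] := wP _ (asboolW okj).
have /(count_flatten_leq (fun j' => `[< same L j j' >])) :
    nseq n (w (tau j)) \in [seq nseq n (w v) | v <- enum T & ok v].
  by apply: map_f; rewrite mem_filter okj mem_enum.
by apply: leq_trans; rewrite count_nseq asboolT // mul1n.
Qed.

(** Greedy choice: fewer than [l] values are taken when the next set is reached. *)
Lemma distinct_representatives l (C : nat -> seq nat) :
  (forall i, i < l -> uniq (C i) /\ l <= size (C i)) ->
  exists rho : nat -> nat, (forall i, i < l -> rho i \in C i) /\
    (forall i i', i < l -> i' < l -> rho i = rho i' -> i = i').
Proof.
move=> CP; suff [rho [h1 h2]] : exists rho : nat -> nat,
    (forall i, i < l -> rho i \in C i) /\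
    (forall i i', i < l -> i' < l -> rho i = rho i' -> i = i') by exists rho.
suff : forall m, m <= l -> exists rho : nat -> nat, (forall i, i < m -> rho i \in C i) /\
    (forall i i', i < m -> i' < m -> rho i = rho i' -> i = i') by move/(_ l (leqnn l)).
elim=> [_|m IH ml]; first by exists id.
have [rho [h1 h2]] := IH (ltnW ml); have [uC lC] := CP m ml.
have [x xC xr] : exists2 x, x \in C m & x \notin [seq rho i | i <- iota 0 m].
  apply: contrapT => h; have /(uniq_leq_size uC) : {subset C m <= [seq rho i | i <- iota 0 m]}.
    by move=> x xC; apply/negPn/negP => xr; apply: h; exists x.
  by rewrite size_map size_iota => /(leq_trans lC); rewrite leqNgt ml.
have xr' i : i < m -> rho i <> x.
  by move=> im e; move/negP: xr; apply; rewrite -e; apply: map_f; rewrite mem_iota.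
exists (fun i => if i == m then x else rho i); split=> [i|i i'].
  by rewrite ltnS leq_eqVlt; case: eqP => [->|_] //= /h1.
rewrite !ltnS (leq_eqVlt i) (leq_eqVlt i'); case: eqP => [->|_]; case: eqP => [->|_] //=.
- by move=> _ /xr' + /esym.
- by move=> /xr'.
- exact: h2.
Qed.

(** Richness gives distinct positions [rho i] of [J'] with the types of the entries of [J]; [phi]
    copies the [i]-th value to position [rho i] and is 0 elsewhere, so it neither creates nor loses
    agreement. *)
Lemma reindex L J J' : rich (size J) L J' -> (forall j, j \in J -> gcoord L j) ->
  exists phi : (nat -> nat) -> (nat -> nat),
    (forall k z, cube k z -> cube k (phi z)) /\
    (forall a, a \in L -> forall z z', agree a J' (phi z) (phi z') <-> agree a J z z').
Proof.
move=> rJ gJ.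
pose C i := [seq i' <- iota 0 (size J') | `[< same L (nth 0 J i) (nth 0 J' i') >]].
have [|rho [rhoC rhoI]] := @distinct_representatives (size J) C.
  move=> i iJ; split; first by rewrite filter_uniq// iota_uniq.
  have := rJ _ (gJ _ (mem_nth 0 iJ)).
  by rewrite -{1}[J'](mkseq_nth 0) count_map /C size_filter.
pose phi (z : nat -> nat) i' := if has (fun i => rho i == i') (iota 0 (size J)) then
   z (find (fun i => rho i == i') (iota 0 (size J))) else 0.
have rhoP i : i < size J -> rho i < size J' /\ same L (nth 0 J i) (nth 0 J' (rho i)).
  by move=> /rhoC; rewrite mem_filter mem_iota => /andP[/asboolP].
have phiE z i : i < size J -> phi z (rho i) = z i.
  move=> iJ; rewrite /phi; case: hasP => [h|[]]; last by exists i; rewrite ?mem_iota.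
  congr z; have /hasP h' := h; set f := find _ _.
  have fJ : f < size J by rewrite -[ltnRHS](size_iota 0 (size J)) -has_find.
  by apply: rhoI => //; have := nth_find 0 h'; rewrite nth_iota// => /eqP.
exists phi; split=> [k z zk i|a aL z z'].
  by rewrite /phi; case: ifP => // _; exact: leq_ltn_trans (leq0n _) (zk 0).
split=> h i iJ ai.
  have [rJ' sJ] := rhoP i iJ.
  by rewrite -(phiE z)// -(phiE z')//; apply: h => //; apply/(sJ a aL).
have [[i0 i0J e]|nh] := pselect (exists2 i0, i0 < size J & rho i0 = i).
  rewrite -e !phiE//; apply: h => //; have [_ sJ] := rhoP _ i0J.
  by apply/(sJ a aL); rewrite e.
have hF : has (fun i0 => rho i0 == i) (iota 0 (size J)) = false.
  by apply/hasP => -[x]; rewrite mem_iota => /andP[_ xJ] /eqP e; apply: nh; exists x.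
by rewrite /phi hF.
Qed.

Lemma leq_cube k k' z : k <= k' -> cube k z -> cube k' z.
Proof. by move=> kk zk i; apply: leq_trans kk. Qed.

Lemma brick1_comp r J J' k k' e (phi : (nat -> nat) -> nat -> nat) :
  k <= k' -> brick1 r J' k' e ->
  (forall z, cube k z -> cube k' (phi z)) ->
  (forall z z', cube k z -> cube k z' ->
     (agree (idx r) J' (phi z) (phi z') <-> agree (idx r) J z z')) ->
  brick1 r J k (e \o phi).
Proof.
move=> kk b pk pa z zk; have [h1 h2 h3] := b _ (pk _ zk).
by split=> //= [|z' zk']; [exact: leq_trans h2|rewrite h3 ?pa//; exact: pk].
Qed.

Lemma brick_leq F J k k' e : k <= k' -> brick F J k' e -> brick F J k e.
Proof.
move=> kk b r rF; apply: (@brick1_comp r J J k k' e id) => //; first exact: b.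
by move=> z; exact: leq_cube.
Qed.

Lemma sub_brick F F' J k e : {subset F' <= F} -> brick F J k e -> brick F' J k e.
Proof. by move=> FF h r /FF; exact: h. Qed.

Lemma sub_good S S' : S `<=` S' -> good S' -> good S.
Proof. by move=> SS h F FS; apply: h => r /FS/SS. Qed.

Lemma good_rich S F k n : good S -> subreq F S ->
  exists J e, brick F J k e /\ rich n (idxs F) J.
Proof.
move=> gS FS; have [J [gJ rJ]] := exists_rich n (idxs F).
by have [e be] := gS F FS J gJ k; exists J, e.
Qed.

(** One rich brick for each finite part and each size is enough: [reindex] extracts from it a brick
    over any prescribed label list. *)
Lemma good_addr S r : good S ->
  (forall F k, subreq F S -> exists J e, brick (r :: F) J k e /\ rich k (idxs (r :: F)) J) ->
  good (addr S r).
Proof.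
move=> gS h F FS J gJ k.
have [rF|rF] := boolP (r \in F); last first.
  apply: gS => // x xF; case: (FS x xF) => // xr; rewrite /= in xr; subst x.
  by rewrite xF in rF.
pose F1 := [seq x <- F | `[< S x >]].
(* [k] is the side wanted, [size J] the richness that [reindex] needs. *)
have [|J' [e [be rJ']]] := h F1 (maxn k (size J)).
  by move=> x; rewrite mem_filter => /andP[/asboolP].
have FF1 x : (x \in F) = (x \in r :: F1).
  rewrite inE mem_filter; apply/idP/orP => [xF|[/eqP->//|/andP[]//]].
  by case: (FS _ xF) => [Sx|->]; [right; rewrite xF asboolT|left].
have [phi [phi1 phi2]] : exists phi : (nat -> nat) -> (nat -> nat),
    (forall k z, cube k z -> cube k (phi z)) /\
    (forall a, a \in idxs F -> forall z z', agree a J' (phi z) (phi z') <-> agree a J z z').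
  apply: reindex => //; apply: (@sub_rich _ (idxs (r :: F1))).
    by move=> _ /mapP[x xF ->]; apply: map_f; rewrite -FF1.
  by apply: rich_leq rJ'; exact: leq_maxr.
exists (e \o phi) => x xF.
apply: (@brick1_comp x J J' k (maxn k (size J))); first exact: leq_maxl.
- by apply: be; rewrite -FF1.
- by move=> z zk; apply: phi1; apply: leq_cube zk; exact: leq_maxl.
- by move=> z z' _ _; apply: phi2; exact: map_f.
Qed.

Lemma good_addr_sub S S' r : S `<=` S' -> good (addr S' r) -> good (addr S r).
Proof. by move=> SS; apply: sub_good => x [/SS|]; [left|right]. Qed.

Lemma brick1_restr X J k e : brick1 (restr setT) J k e ->
  (forall z, cube k z -> X (e z)) -> brick1 (restr X) J k e.
Proof. by move=> b h z zk; have [_ h2 h3] := b z zk; split=> //; exact: h. Qed.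

Lemma good_dom S r X : good S -> S (restr setT) -> S r -> dom r `<=` X ->
  good (addr S (restr X)).
Proof.
move=> gS S0 Sr rX; apply: good_addr => // F k FS.
have [|J [e [be rJ]]] := @good_rich S [:: r, restr setT & F] k k gS.
  by move=> x; rewrite !inE => /or3P[/eqP->|/eqP->|/FS].
exists J, e; split=> [x|].
  rewrite inE => /orP[/eqP->|xF]; last by apply: be; rewrite !inE xF !orbT.
  apply: brick1_restr; first by apply: be; rewrite !inE eqxx orbT.
  move=> z zk; apply: rX; have [] // := be r _ z zk.
  by rewrite inE eqxx.
by apply: sub_rich rJ => a; rewrite /= !inE => ->; rewrite orbT.
Qed.

Lemma good_base : good [set restr setT].
Proof.
(* The code separates the restrictions to [J]; adding [k] gives the lower bound in [brick1]. *)
move=> F FS J _ k; exists (fun z => k + pickle (mkseq z (size J))) => r /FS ->.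
move=> z zk; split=> //=; first by rewrite /mp /=; lia.
move=> z' zk'; rewrite /mp /agree /=; split.
  move=> /addnI/(pcan_inj pickleK) e i iJ _.
  by have := congr1 (fun s => nth 0 s i) e; rewrite !nth_mkseq.
move=> h; congr (k + pickle _); apply: (@eq_from_nth _ 0); rewrite !size_mkseq//.
by move=> i iJ; rewrite !nth_mkseq//; exact: h.
Qed.

(** * The product Ramsey theorem and fusion sequences *)

Lemma sum_count_fibers (C : finType) (c : nat -> C) s :
  \sum_(v : C) count (fun x => c x == v) s = size s.
Proof.
elim: s => [|x s IH] /=; first by rewrite big1.
rewrite big_split /= IH (bigD1 (c x)) //= eqxx big1 ?addn0 ?add1n// => v.
by rewrite eq_sym => /negbTE->.
Qed.

Lemma pigeonhole (C : finType) (c : nat -> C) k : exists g v,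
  [/\ forall x, x < k -> g x < k * #|C|,
      forall x y, x < k -> y < k -> g x = g y -> x = y &
      forall x, x < k -> c (g x) = v].
Proof.
have [->|k0] := posnP k; first by exists id, (c 0).
have [v vP] : exists v, k <= count (fun x => c x == v) (iota 0 (k * #|C|)).
  apply: contrapT => /forallNP h.
  have : \sum_(v : C) count (fun x => c x == v) (iota 0 (k * #|C|)) <= \sum_(v : C) k.-1.
    by apply: leq_sum => v _; have := h v; lia.
  have C0 : 0 < #|C| by apply/card_gt0P; exists (c 0).
  rewrite sum_count_fibers size_iota sum_nat_const mulnC leq_pmul2l//.
  by case: (k) k0 => // k' _; rewrite ltnn.
pose s := [seq x <- iota 0 (k * #|C|) | c x == v].
have ks : k <= size s by rewrite size_filter.
have us : uniq s by rewrite filter_uniq// iota_uniq.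
exists (nth 0 s), v; split=> [x xk|x y xk yk /eqP|x xk].
- have := mem_nth 0 (leq_trans xk ks).
  by rewrite mem_filter mem_iota add0n => /andP[_ /andP[_]].
- by rewrite nth_uniq ?(leq_trans _ ks)// => /eqP.
- have := mem_nth 0 (leq_trans xk ks).
  by rewrite mem_filter => /andP[/eqP].
Qed.

Fixpoint cubes l k : seq (seq nat) :=
  if l is l'.+1 then [seq x :: s | x <- iota 0 k, s <- cubes l' k] else [:: [::]].

Lemma mem_cubes l k z : cube k z -> mkseq z l \in cubes l k.
Proof.
elim: l z => [|l IH] z zk //.
have -> : mkseq z l.+1 = z 0 :: mkseq (fun i => z i.+1) l.
  by rewrite /mkseq /= -[1]/(1 + 0) iotaDl -map_comp.
apply: allpairs_f; first by rewrite mem_iota /= add0n.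
by apply: IH => i; exact: zk.
Qed.

Lemma size_cubes l k : size (cubes l k) = k ^ l.
Proof. by elim: l => //= l IH; rewrite size_allpairs size_iota IH expnS. Qed.

Lemma cube_nth_cubes l k s : 0 < k -> s \in cubes l k -> cube k (nth 0 s).
Proof.
move=> k0; elim: l s => [|l IH] s.
  by rewrite inE => /eqP-> i; rewrite nth_nil.
move=> /allpairsP[[x t] /= [xk tk ->]] [|i] /=.
  by move: xk; rewrite mem_iota add0n => /andP[].
exact: IH.
Qed.

(** Induction on the dimension. A value of the first coordinate is coloured by the whole table of
    colours that it induces on the remaining cube of side [K]; [k] values share a table, and the
    induction hypothesis applies to that table. *)
Lemma product_ramsey l k : exists K, k <= K /\ forall chi : (nat -> nat) -> bool,
  (forall z z', cube K z -> cube K z' -> (forall i, i < l -> z i = z' i) ->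
     chi z = chi z') ->
  exists h : nat -> nat -> nat,
   [/\ forall i x, x < k -> h i x < K,
       forall i x y, x < k -> y < k -> h i x = h i y -> x = y &
       exists v, forall z, cube k z -> chi (fun i => h i (z i)) = v].
Proof.
have [->|k0] := posnP k.
  exists 0; split=> // chi _; exists (fun=> id); split=> //; exists true => z zk.
  by have := zk 0.
elim: l => [|l [K [kK KP]]].
  exists k; split=> // chi chiP; exists (fun=> id); split=> //.
  by exists (chi (fun=> 0)) => z zk; apply: chiP.
pose ccons x (z : nat -> nat) := fun i => if i is i'.+1 then z i' else x.
pose C := ((size (cubes l K)).-tuple bool)%type.
pose K' := maxn K (k * #|{: C}|).
have KK' : K <= K' := leq_maxl _ _.
exists K'; split=> [|chi chiP]; first exact: leq_trans KK'.
pose c x : C := map_tuple (fun s => chi (ccons x (nth 0 s))) (in_tuple (cubes l K)).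
have [g [v [gK gI gv]]] := pigeonhole c k.
have gK' x : x < k -> g x < K' by move=> /gK h; apply: leq_trans h (leq_maxr _ _).
have ccube x z : x < K' -> cube K z -> cube K' (ccons x z).
  by move=> xK zK [|i] //=; exact: leq_trans KK'.
have [z z' zK zK' zz'|h' [hK hI [w hw]]] := KP (fun z => chi (ccons (g 0) z)).
  by apply: chiP => [||[|i] //=]; [exact/ccube/zK/gK'|exact/ccube/zK'/gK'|exact: zz'].
exists (fun i => if i is i'.+1 then h' i' else g); split.
- by move=> [|i] x xk; [exact: gK'|apply: leq_trans KK'; exact: hK].
- by move=> [|i] x y; [exact: gI|exact: hI].
exists w => z zk.
pose y i := h' i (z i.+1).
have yK : cube K y by move=> i; exact: hK.
have -> : (fun i => (if i is i'.+1 then h' i' else g) (z i)) = ccons (g (z 0)) y.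
  by apply/funext => -[|i].
have yE x : x < k -> chi (ccons (g x) y) = nth false (c (g x)) (index (mkseq y l) (cubes l K)).
  move=> xk; rewrite (nth_map [::]) ?index_mem ?mem_cubes//.
  rewrite nth_index ?mem_cubes//; apply: chiP.
  - by apply: ccube => //; exact: gK'.
  - apply: ccube; first exact: gK'.
    by apply: (@cube_nth_cubes l); [exact: leq_trans kK|exact: mem_cubes].
  - by move=> [|i] //= il; rewrite nth_mkseq.
rewrite yE// gv// -(gv 0)// -yE//.
by rewrite (hw (fun i => z i.+1)) => // i; exact: zk.
Qed.

Lemma not_good_addr S r : good S -> ~ good (addr S r) ->
  exists F k, subreq F S /\ forall J e, brick (r :: F) J k e -> ~ rich k (idxs (r :: F)) J.
Proof.
move=> gS ng; apply: contrapT => h; apply: ng; apply: good_addr => // F k FS.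
apply: contrapT => h'; apply: h; exists F, k; split=> // J e b rJ.
by apply: h'; exists J, e.
Qed.

(** If neither set could be added, each failure would have a finite witness. A large brick for both
    witnesses contains, by [product_ramsey], a subcube of side [k] mapped into [X] or into its
    complement, against one of them. *)
Lemma good_decide S X : good S -> S (restr setT) ->
  good (addr S (restr X)) \/ good (addr S (restr (~` X))).
Proof.
move=> gS S0; apply: contrapT => /not_orP[/(not_good_addr gS)[F1 [k1 [F1S h1]]]].
move=> /(not_good_addr gS)[F2 [k2 [F2S h2]]].
pose F := restr setT :: F1 ++ F2; pose k := maxn k1 k2.
have FS : subreq F S.
  by move=> x; rewrite inE mem_cat => /or3P[/eqP->|/F1S|/F2S].
have [J [gJ rJ]] := exists_rich k (idxs F).
have [K [kK KP]] := product_ramsey (size J) k.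
have [e be] := gS F FS J gJ K.
have be0 : brick1 (restr setT) J K e by apply: be; rewrite inE eqxx.
(* By [restr setT], the map [e] and hence the colouring depend only on the first [size J] values. *)
have [|h [hK hI [v hv]]] := KP (fun z => `[< X (e z) >]).
  move=> z z' zK zK' zz'; have [_ _ /(_ z' zK')[_]] := be0 z zK.
  by rewrite /mp /= => -> // i iJ _; exact: zz'.
pose phi (z : nat -> nat) i := h i (z i).
have bphi : brick F J k (e \o phi).
  move=> r rF; apply: (@brick1_comp r J J k K) => //; first exact: be.
    by move=> z zk i; apply: hK.
  move=> z z' zk zk'; split=> a i iJ ai; last by rewrite /phi a.
  by apply: (hI i) => //; exact: a.
have bphi0 := bphi (restr setT); rewrite inE eqxx in bphi0.
case: v hv => hv.
  apply: (h1 J (e \o phi)).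
    apply: (@brick_leq _ _ _ k); first exact: leq_maxl.
    move=> r; rewrite inE => /orP[/eqP->|rF]; last first.
      by apply: bphi; rewrite inE mem_cat rF orbT.
    apply: brick1_restr; first exact: bphi0.
    by move=> z zk; apply/asboolP; exact: hv.
  apply: (@sub_rich _ (idxs F)); last by apply: rich_leq rJ; exact: leq_maxl.
  by move=> a; rewrite /idxs /= !inE map_cat mem_cat => /orP[->//|->]; rewrite orbT.
apply: (h2 J (e \o phi)).
  apply: (@brick_leq _ _ _ k); first exact: leq_maxr.
  move=> r; rewrite inE => /orP[/eqP->|rF]; last first.
    by apply: bphi; rewrite inE mem_cat rF !orbT.
  apply: brick1_restr; first exact: bphi0.
  by move=> z zk; apply/asboolPn; rewrite hv.
apply: (@sub_rich _ (idxs F)); last by apply: rich_leq rJ; exact: leq_maxr.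
by move=> a; rewrite /idxs /= !inE map_cat mem_cat => /orP[->//|->]; rewrite !orbT.
Qed.

(* Coordinate labels, side, and the list of values over [cubes]: bricks must range
   over a countable type for the poset of finite approximations to be
   sigma-centered. *)
Definition tbrick := (seq nat * nat * seq nat)%type.
Definition lab (b : tbrick) := b.1.1.
Definition side (b : tbrick) := b.1.2.
(** The leading 0 is the default of [nth] in [eval], so every value of [eval] is listed, even off
    the cube. *)
Definition vals (b : tbrick) := 0 :: b.2.
Definition eval (b : tbrick) (z : nat -> nat) :=
  nth 0 b.2 (index (mkseq z (size (lab b))) (cubes (size (lab b)) (side b))).
Definition tabulate J k (e : (nat -> nat) -> nat) : tbrick :=
  (J, k, [seq e (nth 0 s) | s <- cubes (size J) k]).

Lemma eval_vals b z : eval b z \in vals b.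
Proof.
rewrite /eval /vals inE; set i := index _ _.
have [ib|ib] := ltnP i (size b.2); first by rewrite mem_nth ?orbT.
by rewrite nth_default ?eqxx.
Qed.

Lemma tabulateE J k e z : brick1 (restr setT) J k e -> cube k z ->
  eval (tabulate J k e) z = e z.
Proof.
move=> be zk; have zc := mem_cubes (size J) zk.
rewrite /eval (nth_map [::]) ?index_mem// nth_index//.
have k0 : 0 < k by apply: leq_ltn_trans (zk 0).
have [_ _ /(_ z zk)[_]] := be _ (cube_nth_cubes k0 zc).
by apply=> i iJ _; rewrite nth_mkseq.
Qed.

(* The exponential lower bound on the side leaves room to avoid one value for each
   set of points from the earlier bricks and from a subcube of side [size s], up to
   fibers of a map ignoring one coordinate; see [shrink]. *)
Definition fused (c : set nat) (L : seq req) (s : seq tbrick) (b : tbrick) :=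
  let n := size s in
  [/\ brick L (lab b) (side b) (eval b),
      forall j, j \in lab b -> gcoord (c :: idxs L) j,
      rich n (c :: idxs L) (lab b),
      n + 2 ^ (size (flatten (map vals s)) + n ^ size (lab b)) <= side b &
      forall b', b' \in s -> forall z z', cube (side b) z' ->
        forall r, r \in L -> mp r (eval b' z) < mp r (eval b z')].

(** Any finite part of the stage admits a next brick: goodness gives bricks of every side, and a
    side exceeding all earlier values yields the separation clause of [fused]. *)
Lemma good_fusion S c : MA_sigma_centered -> small S -> good S -> S (restr setT) ->
  exists b : nat -> tbrick, forall L, subreq L S ->
    exists N, forall n, N <= n -> fused c L (mkseq b n) (b n).
Proof.
move=> MA smS gS S0; apply: (@fusion _ _ S (fused c) ([::], 0, [::])) => //.
  move=> L L' s b LL [h1 h2 h3 h4 h5].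
  have cLL : {subset c :: idxs L <= c :: idxs L'}.
    move=> a; rewrite !inE => /orP[->//|/mapP[r rL ->]].
    by rewrite map_f ?orbT//; exact: LL.
  split=> //.
  - exact: sub_brick h1.
  - by move=> j /h2; exact: sub_gcoord.
  - exact: sub_rich h3.
  - by move=> b' /h5 h z z' zk r /LL; exact: h.
move=> L s LS; set n := size s.
have [J [gJ rJ]] := exists_rich n [:: c, setT & idxs L].
pose V := flatten (map vals s).
pose M := \max_(r <- L) \max_(x <- V) mp r x.
pose k := (n + 2 ^ (size V + n ^ size J) + M).+1.
have [||e be] := gS (restr setT :: L) _ J _ k.
- by move=> r; rewrite inE => /orP[/eqP->|/LS].
- by move=> j /gJ; apply: sub_gcoord => a ha; rewrite inE; apply/orP; right.
have be0 : brick1 (restr setT) J k e by apply: be; rewrite inE eqxx.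
have beL : brick L J k (eval (tabulate J k e)).
  move=> r rL z zk; have : brick1 r J k e by apply: be; rewrite inE rL orbT.
  move=> /(_ z zk)[h1 h2 h3]; rewrite !tabulateE//; split=> // z' zk'.
  by rewrite tabulateE//; exact: h3.
have sub : {subset c :: idxs L <= [:: c, setT & idxs L]}.
  by move=> a; rewrite !inE => /orP[->//|->]; rewrite !orbT.
exists (tabulate J k e); split=> //.
- by move=> j /gJ; exact: sub_gcoord.
- exact: sub_rich rJ.
- by apply: leqW; exact: leq_addr.
- move=> b' b's z z' zk' r rL; have [_ h _] := beL r rL z' zk'.
  suff hM : mp r (eval b' z) <= M.
    by apply: leq_trans h; rewrite /k ltnS; apply: leq_trans hM _; exact: leq_addl.
  apply: leq_trans _ (@leq_bigmax_seq _ L xpredT (fun r => \max_(x <- V) mp r x) r rL isT).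
  apply: (@leq_bigmax_seq _ V xpredT (fun x => mp r x) (eval b' z)) => //.
  by apply/flatten_mapP; exists b' => //; exact: eval_vals.
Qed.

(** * Ultrafilter, P-point and index steps *)

Definition fused_seq c (S : set req) (b : nat -> tbrick) :=
  forall L, subreq L S -> exists N, forall n, N <= n -> fused c L (mkseq b n) (b n).

Lemma fused_sep c L (b : nat -> tbrick) n m z z' r : fused c L (mkseq b n) (b n) ->
  m < n -> r \in L -> cube (side (b n)) z' ->
  mp r (eval (b m) z) < mp r (eval (b n) z').
Proof.
move=> [_ _ _ _ h] mn rL zk; apply: h => //; apply/mapP; exists m => //.
by rewrite mem_iota add0n.
Qed.

Lemma fused_side c L (b : nat -> tbrick) n : fused c L (mkseq b n) (b n) -> n <= side (b n).
Proof. by move=> [_ _ _ h _]; rewrite size_mkseq in h; apply: leq_trans h; exact: leq_addr. Qed.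

(** Far enough out, a single brick of the sequence serves both [r] and any given finite part of [S],
    and its labels are rich for [c] as well, as [good_addr] requires. *)
Lemma good_addr_fused S c b r : fused_seq c S b -> good S -> S (restr setT) ->
  idx r \in [:: c; setT] ->
  (forall k, exists N, forall n, N <= n -> brick1 r (lab (b n)) k (eval (b n))) ->
  good (addr S r).
Proof.
move=> hb gS S0 ir br; apply: good_addr => // F k FS.
have [|N NP] := hb (restr setT :: F).
  by move=> x; rewrite inE => /orP[/eqP->|/FS].
have [N' N'P] := br k; pose n := maxn k (maxn N N').
have fn : fused c (restr setT :: F) (mkseq b n) (b n).
  by apply: NP; rewrite /n !leq_max leqnn orbT.
have kn : k <= n := leq_maxl _ _.
have kb : k <= side (b n) := leq_trans kn (fused_side fn).
exists (lab (b n)), (eval (b n)); case: fn => h1 _ h3 _ _; split.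
  move=> x; rewrite inE => /orP[/eqP->|xF].
    by apply: N'P; rewrite /n !leq_max leqnn !orbT.
  by apply: (brick_leq kb h1); rewrite inE xF orbT.
rewrite size_mkseq in h3; apply: (@sub_rich _ (c :: idxs (restr setT :: F))).
  move=> a; rewrite /= !inE => /orP[/eqP->|->]; last by rewrite !orbT.
  by move: ir; rewrite !inE orbA => ->.
exact: rich_leq h3.
Qed.

Lemma finite_set_natP (A : set nat) : finite_set A <-> exists M, forall x, A x -> x < M.
Proof.
split=> [/finite_seqP[s sA]|[M AM]].
  exists (\max_(x <- s) x).+1 => x; rewrite sA /= => xs.
  by rewrite ltnS; exact: (@leq_bigmax_seq _ s xpredT id).
by apply: sub_finite_set (finite_II M) => x /AM.
Qed.

Lemma vals_bounded (f : nat -> nat) (b : nat -> tbrick) N : exists M, forall n z,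
  n < N -> f (eval (b n) z) < M.
Proof.
exists (\max_(x <- flatten (mkseq (vals \o b) N)) f x).+1 => n z nN; rewrite ltnS.
apply: (@leq_bigmax_seq _ _ xpredT f) => //.
by apply/flatten_mapP; exists n; [rewrite mem_iota|exact: eval_vals].
Qed.

(** A coordinate in [c] outside [a] would have infinitely many companions of its type, so almost
    inclusion becomes inclusion on recurring types. *)
Lemma gcoord_almost_subset c a L j : c \in L -> a \in L -> c `<=* a -> gcoord L j ->
  c j -> a j.
Proof.
move=> cL aL /finite_set_natP[M MP] gj cj; apply: contrapT => naj.
have [j' Mj' sj] := gj M.
have : j' < M by apply: MP; split; [apply/(sj c cL)|move/(sj a aL)].
by rewrite ltnNge Mj'.
Qed.

(** A pairing bounded below by its first component, so that maps built with it meet the lower bound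
    in [brick1]. *)
Definition code (n p : nat) := CodeSeq.code [:: n; p].

Lemma code_inj n p n' p' : code n p = code n' p' -> n = n' /\ p = p'.
Proof. by move=> /(can_inj CodeSeq.codeK)[-> ->]. Qed.

Lemma leq_code n p : n <= code n p.
Proof.
rewrite /code /=; apply: leq_trans (ltnW (ltn_expl n (isT : 1 < 2))) _.
by rewrite leq_pmulr.
Qed.

Definition proj (c : set nat) J (z : nat -> nat) :=
  pickle (mkseq (fun i => if `[< c (nth 0 J i) >] then (z i).+1 else 0) (size J)).

Lemma projP c J z z' : proj c J z = proj c J z' <-> agree c J z z'.
Proof.
split=> [/(pcan_inj pickleK) e i iJ ci|h].
  have := congr1 (fun s => nth 0 s i) e; rewrite !nth_mkseq// asboolT//.
  by case.
congr pickle; apply/eq_in_map => i; rewrite mem_iota => /andP[_ iJ].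
by case: asboolP => // ci; rewrite (h i iJ ci).
Qed.

Definition factors (X : set nat) (f g : nat -> nat) :=
  forall u v, X u -> X v -> g u = g v -> f u = f v.

Definition RK_coherent (S : set req) (r : req) := forall r', S r' -> exists N,
  let X := dom r `&` [set u | N <= u] in
  (idx r' `<=* idx r -> factors X (mp r') (mp r)) /\
  (idx r `<=* idx r' -> factors X (mp r) (mp r')).

(** [f] sends a point to its brick number and its coordinates in [c]. Separation recovers the brick
    number from [mp r'], and almost inclusion of index sets is inclusion on the labels used, so the
    factorings hold past finitely many bricks. *)
Lemma step_index S c : MA_sigma_centered -> small S -> good S -> S (restr setT) ->
  exists r, [/\ idx r = c, good (addr S r) & RK_coherent S r].
Proof.
move=> MA smS gS S0; have [b bP] := good_fusion c MA smS gS S0.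
have [|N0 N0P] := bP [:: restr setT]; first by move=> x; rewrite inE => /eqP->.
pose pt n z u := [/\ N0 <= n, cube (side (b n)) z & u = eval (b n) z].
have pt_inj n z n' z' u : pt n z u -> pt n' z' u ->
    n = n' /\ forall i, i < size (lab (b n)) -> z i = z' i.
  move=> [Nn zk ->] [Nn' zk' e].
  have [nn|nn|nn] := ltngtP n n'.
  - have := fused_sep z (N0P _ Nn') nn (mem_head _ _) zk'.
    by rewrite /mp /= -e ltnn.
  - have := fused_sep z' (N0P _ Nn) nn (mem_head _ _) zk.
    by rewrite /mp /= -e ltnn.
  subst n'; split=> // i iJ; have [hb _ _ _ _] := N0P _ Nn.
  by have [_ _ /(_ z' zk')[/(_ e) h _]] := hb _ (mem_head _ _) z zk; exact: h.
have /choice[f fP] : forall u, exists m, forall n z, pt n z u ->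
    m = code n (proj c (lab (b n)) z).
  move=> u; have [[n [z p]]|h] := pselect (exists n z, pt n z u); last first.
    by exists 0 => n z p; case: h; exists n, z.
  exists (code n (proj c (lab (b n)) z)) => n' z' p'.
  have [e zz] := pt_inj _ _ _ _ _ p p'; subst n'; congr code; apply/projP => i iJ _.
  exact: zz.
have fE n z : N0 <= n -> cube (side (b n)) z ->
    f (eval (b n) z) = code n (proj c (lab (b n)) z) by move=> Nn zk; exact: fP.
pose d : set nat := [set u | exists n z, pt n z u].
exists (d, c, f); split=> //.
  apply: (good_addr_fused bP) => //; first by rewrite inE eqxx.
  move=> k; exists (maxn k N0) => n; rewrite geq_max => /andP[kn Nn] z zk.
  have kb : k <= side (b n) by apply: leq_trans kn (fused_side (N0P _ Nn)).
  have zb := leq_cube kb zk; split.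
  - by exists n, z.
  - by rewrite /mp /= fE//; apply: leq_trans kn (leq_code _ _).
  - move=> z' zk'; have zb' := leq_cube kb zk'.
    rewrite /mp /= !fE// /idx /=; split=> [/code_inj[_ /projP]//|/projP->//].
move=> r' Sr'.
have [|N1 N1P] := bP [:: r'; restr setT].
  by move=> x; rewrite !inE => /orP[/eqP->//|/eqP->].
(* Past [N], only bricks that already respect [r'] contribute points. *)
have [N NP] := vals_bounded id b N1.
exists N; have big n z u : pt n z u -> N <= u -> N1 <= n.
  move=> [_ _ ->] Nu; rewrite leqNgt; apply/negP => /(NP _ z) /=.
  by rewrite ltnNge Nu.
have a_in : idx r' \in c :: idxs [:: r'; restr setT] by rewrite !inE eqxx orbT.
have c_in : c \in c :: idxs [:: r'; restr setT] by rewrite inE eqxx.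
have r'L := mem_head r' [:: restr setT].
split=> sub u v [[n [z p]] /(big _ _ _ p) Nn] [[n' [z' p']] /(big _ _ _ p') Nn'].
  have [Nn0 zk ->] := p; have [Nn0' zk' ->] := p'.
  rewrite /mp /= !fE// => /code_inj[e]; subst n' => /projP ag.
  have [hb hg _ _ _] := N1P _ Nn.
  have [_ _ /(_ z' zk')[_ h]] := hb _ r'L z zk; apply: h => i iJ ai.
  by apply: ag => //; apply: gcoord_almost_subset sub (hg _ (mem_nth 0 iJ)) ai.
have [Nn0 zk ->] := p; have [Nn0' zk' ->] := p'.
have [nn|nn|nn] := ltngtP n n'.
- by move=> e; have := fused_sep z (N1P _ Nn') nn r'L zk'; rewrite e ltnn.
- by move=> e; have := fused_sep z' (N1P _ Nn) nn r'L zk; rewrite e ltnn.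
subst n'; have [hb hg _ _ _] := N1P _ Nn => e.
have [_ _ /(_ z' zk')[/(_ e) ag _]] := hb _ r'L z zk.
rewrite /mp /= !fE//; congr code; apply/projP => i iJ ci.
by apply: ag => //; apply: gcoord_almost_subset sub (hg _ (mem_nth 0 iJ)) ci.
Qed.

Lemma step_decide S X : good S -> S (restr setT) ->
  exists r, good (addr S r) /\ (dom r `<=` X \/ dom r `<=` ~` X).
Proof.
move=> gS S0; have [g|g] := good_decide X gS S0.
  by exists (restr X); split=> //; left.
by exists (restr (~` X)); split=> //; right.
Qed.

Lemma good_restrI S X Y Z : good (addr (addr S (restr X)) (restr Y)) ->
  S (restr setT) -> X `&` Y `<=` Z -> good (addr S (restr Z)).
Proof.
move=> g S0 XYZ; have SS : S `<=` addr (addr S (restr X)) (restr Y).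
  by move=> x Sx; left; left.
apply: good_addr => [|F k FS]; first exact: sub_good g.
have [|J [e [be rJ]]] := @good_rich _ [:: restr X, restr Y, restr setT & F] k k g.
  move=> x; rewrite !inE => /or4P[/eqP->|/eqP->|/eqP->|/FS/SS//].
  - by left; right.
  - by right.
  - exact: SS.
exists J, e; split=> [x|].
  rewrite inE => /orP[/eqP->|xF]; last by apply: be; rewrite !inE xF !orbT.
  apply: brick1_restr; first by apply: be; rewrite !inE eqxx !orbT.
  move=> z zk; apply: XYZ; split.
    by have [] // := be (restr X) _ z zk; rewrite inE eqxx.
  by have [] // := be (restr Y) _ z zk; rewrite !inE eqxx orbT.
by apply: sub_rich rJ => a; rewrite /= !inE => ->; rewrite !orbT.
Qed.

Lemma gcoord_setT L j : gcoord L j -> gcoord (setT :: L) j.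
Proof.
move=> h M; have [j' Mj' sj] := h M; exists j' => // a.
by rewrite inE => /orP[/eqP->//|]; exact: sj.
Qed.

(** Either some fibre of [h] can be added, or all sets [m <= h] can be added together; a fusion
    sequence for the enlarged stage is eventually inside each of them, so [h] is finite-to-one on
    its union. *)
Lemma step_P_point S (h : nat -> nat) : MA_sigma_centered -> small S -> good S ->
  S (restr setT) -> exists r, good (addr S r) /\
    ((forall m, finite_set (dom r `&` h @^-1` [set m])) \/
     exists c, forall x, dom r x -> h x = c).
Proof.
move=> MA smS gS S0.
have [[c gc]|nc] := pselect (exists c, good (addr S (restr (h @^-1` [set c])))).
  by exists (restr (h @^-1` [set c])); split=> //; right; exists c.
pose T m : req := restr [set u | m <= h u].
have gT m : good (addr S (T m)).
  elim: m => [|m IH]; first by apply: (good_dom gS S0 S0).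
  have [g|g] := good_decide (h @^-1` [set m]) IH (or_introl S0).
    by case: nc; exists m; apply: good_addr_sub g => x; left.
  apply: good_restrI g S0 _ => u [/= mh nh].
  by rewrite ltn_neqAle mh andbT; apply/eqP => /esym.
pose S' := S `|` (T @` setT).
have S'0 : S' (restr setT) by left.
have gS' : good S'.
  move=> F FS J gJ k.
  (* The sets [m <= h] decrease, so a finite list only needs one large [m]. *)
  have [m mP] : exists m, forall x, x \in F -> S x \/ exists2 m', m' <= m & x = T m'.
    elim: (F) FS => [|x G IH] GS; first by exists 0.
    have [y yG|m mP] := IH; first by apply: GS; rewrite inE yG orbT.
    case: (GS x (mem_head _ _)) => [Sx|[m' _ xE]].
      by exists m => y; rewrite inE => /orP[/eqP->|/mP//]; left.
    exists (maxn m m') => y; rewrite inE => /orP[/eqP->|/mP[|[m1 m1m ->]]]; last 2 first.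
    - by left.
    - by right; exists m1 => //; apply: leq_trans m1m (leq_maxl _ _).
    - by right; exists m' => //; exact: leq_maxr.
  pose F1 := [seq x <- F | `[< S x >]].
  have [||e be] := gT m [:: T m, restr setT & F1] _ J _ k.
  - move=> x; rewrite !inE => /or3P[/eqP->|/eqP->|]; [by right|by left|].
    by rewrite mem_filter => /andP[/asboolP]; left.
  - move=> j /gJ gj; do 2 apply: gcoord_setT; apply: sub_gcoord gj => a.
    by move=> /mapP[x]; rewrite mem_filter => /andP[_ xF] ->; exact: map_f.
  exists e => x xF; have [Sx|[m' mm ->]] := mP _ xF.
    by apply: be; rewrite !inE mem_filter xF asboolT ?orbT.
  apply: brick1_restr; first by apply: be; rewrite !inE eqxx orbT.
  move=> z zk; have [] := be (T m) (mem_head _ _) z zk.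
  by move=> /(leq_trans mm).
have smS' : small S' by apply: small_setU => //; apply: small_image; exact: small_nat.
have [b bP] := good_fusion setT MA smS' gS' S'0.
pose d : set nat := [set u | exists n z, cube (side (b n)) z /\ u = eval (b n) z].
exists (restr d); split.
  apply: (@good_addr_sub _ S'); first by move=> x; left.
  apply: (good_addr_fused bP) => //; first by rewrite !inE eqxx.
  have [|N NP] := bP [:: restr setT]; first by move=> x; rewrite inE => /eqP->.
  move=> k; exists (maxn N k) => n; rewrite geq_max => /andP[Nn kn].
  have fn := NP _ Nn; have kb : k <= side (b n) by apply: leq_trans kn (fused_side fn).
  apply: brick1_restr; first by case: fn => h1 _ _ _ _; exact: (brick_leq kb h1 (mem_head _ _)).
  by move=> z zk; exists n, z; split=> //; exact: leq_cube zk.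
left=> m; apply/finite_set_natP.
have [|N NP] := bP [:: T m.+1]; first by move=> x; rewrite inE => /eqP->; right; exists m.+1.
have [M MP] := vals_bounded id b N.
exists M => u [[n [z [zk ->]]] /= hm]; apply: (MP n z); rewrite ltnNge; apply/negP => Nn.
have [h1 _ _ _ _] := NP _ Nn; have [] := h1 _ (mem_head _ _) z zk.
by rewrite /dom /= hm ltnn.
Qed.

(** * The Tukey step *)

Fixpoint subseqs (W : seq nat) : seq (seq nat) :=
  if W is x :: W' then [seq x :: s | s <- subseqs W'] ++ subseqs W' else [:: [::]].

Lemma filter_subseqs (p : pred nat) W : [seq x <- W | p x] \in subseqs W.
Proof.
elim: W => //= x W IH; rewrite mem_cat; case: (p x); last by rewrite IH orbT.
by rewrite map_f.
Qed.

Lemma size_subseqs W : size (subseqs W) = 2 ^ size W.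
Proof. by elim: W => //= x W IH; rewrite size_cat size_map IH expnS mul2n addnn. Qed.

(* [R s] stands for the set of points forced into the value of a monotone map
   by the finite set [s]; finite sets are represented by lists. *)
Definition monotone_rel (R : seq nat -> set nat) :=
  forall s s', {subset s <= s'} -> R s `<=` R s'.
Definition tame_rel (R : seq nat -> set nat) (E : set nat) := forall s k, exists l,
  forall s', (forall x, x \in s' -> E x /\ l <= x) -> R (s ++ s') k -> R s k.

Lemma monotone_filter R (W s : seq nat) : monotone_rel R -> {subset s <= W} ->
  R [seq x <- W | x \in s] = R s.
Proof.
move=> mR sW; apply/seteqP; split; apply: mR => x; rewrite mem_filter.
  by move=> /andP[].
by move=> xs; rewrite xs sW.
Qed.

(** By monotonicity only the trace of [s] on [W] matters, so finitely many pairs have to be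
    bounded. *)
Lemma uniform_tame R E (W U : seq nat) : monotone_rel R -> tame_rel R E -> exists l,
  forall s k s', {subset s <= W} -> k \in U -> (forall x, x \in s' -> E x /\ l <= x) ->
    R (s ++ s') k -> R s k.
Proof.
move=> mR tR.
have /choice[l lP] : forall sk : seq nat * nat, exists l, forall s',
    (forall x, x \in s' -> E x /\ l <= x) -> R (sk.1 ++ s') sk.2 -> R sk.1 sk.2.
  by move=> [s k]; exact: tR.
pose P := [seq (s, k) | s <- subseqs W, k <- U].
exists (\max_(p <- P) l p) => s k s' sW kU s'E Rk.
pose v := [seq x <- W | x \in s].
have vP : (v, k) \in P by apply: allpairs_f => //; exact: filter_subseqs.
rewrite -(monotone_filter mR sW); apply: (lP (v, k) s') => /=.
  move=> x /s'E[Ex lx]; split=> //; apply: leq_trans lx.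
  exact: (@leq_bigmax_seq _ P xpredT l).
apply: mR Rk => x; rewrite !mem_cat mem_filter => /orP[xs|->]; last by rewrite orbT.
by rewrite xs sW.
Qed.

Section Shrink.
Variables (b : nat -> tbrick) (n : nat) (ra rb : req) (R : seq nat -> set nat).
Hypothesis mR : monotone_rel R.
Hypothesis fused_n : fused setT [:: ra; rb; restr setT] (mkseq b n) (b n).
Hypothesis n0 : 0 < n.
Hypothesis ba : ~ idx rb `<=* idx ra.

Let V := flatten (map vals (mkseq b n)).
Let e := eval (b n).
Let J := lab (b n).
Let K := side (b n).

(** Fix a coordinate [i] labelled in the index set of [rb] but not of [ra]. The relevant
    [mp ra]-values form a finite list [W]; for each sublist [v], one point of the cube forced by
    [v], if any, is selected and its [i]-th value banned. The side leaves [n] values, and changing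
    coordinate [i] does not alter [mp ra]-values. *)
Lemma shrink : exists phi : (nat -> nat) -> nat -> nat,
 [/\ forall z, cube n z -> cube K (phi z),
     forall a z z', cube n z -> cube n z' -> (agree a J (phi z) (phi z') <-> agree a J z z') &
     forall s z, (forall x, x \in s -> x \in map (mp ra) V \/
          exists2 z', cube n z' & x = mp ra (e (phi z'))) ->
       cube K z -> R s (mp rb (e z)) ->
       exists2 z0, cube K z0 & R s (mp rb (e z0)) /\
         forall z', cube n z' -> mp rb (e z0) <> mp rb (e (phi z'))].
Proof.
have [hb hg hr hK _] := fused_n; rewrite size_mkseq -/V -/J -/K in hr hK.
have [i [iJ bi nai]] : exists i, [/\ i < size J, idx rb (nth 0 J i) & ~ idx ra (nth 0 J i)].
  (* The difference being infinite, some label in it is past [M], hence of a recurring type, and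
     richness puts that type into [J]. *)
  have [M MP] := gcoord_cofinite (setT :: idxs [:: ra; rb; restr setT]).
  have [j [bj naj Mj]] : exists j, [/\ idx rb j, ~ idx ra j & M <= j].
    apply: contrapT => h; apply: ba; apply/finite_set_natP; exists M => j [bj naj].
    by rewrite ltnNge; apply/negP => Mj; apply: h; exists j.
  have := leq_trans n0 (hr _ (MP _ Mj)).
  rewrite -has_count => /hasP[x xJ /asboolP sx].
  exists (index x J); rewrite index_mem nth_index//; split=> //.
    by apply/(sx (idx rb)); rewrite // !inE eqxx !orbT.
  by move/(sx (idx ra)) => h; apply: naj; apply: h; rewrite !inE eqxx !orbT.
have nK : n <= K by apply: leq_trans hK; exact: leq_addr.
pose T := [seq mp ra (e (nth 0 s)) | s <- cubes (size J) n].
pose W := map (mp ra) V ++ T.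
have /choice[z0 z0P] : forall v, exists z0, (exists2 z, cube K z & R v (mp rb (e z))) ->
    cube K z0 /\ R v (mp rb (e z0)).
  move=> v; have [[z zK Rz]|h] := pselect (exists2 z, cube K z & R v (mp rb (e z))).
    by exists z.
  by exists id.
pose bad := [seq z0 v i | v <- subseqs W].
pose ok := [seq x <- iota 0 K | x \notin bad].
have szW : size W = size V + n ^ size J by rewrite size_cat !size_map size_cubes.
have nok : n <= size ok.
  have : size [seq x <- iota 0 K | x \in bad] <= size bad.
    apply: uniq_leq_size; first by rewrite filter_uniq// iota_uniq.
    by move=> x; rewrite mem_filter => /andP[].
  rewrite size_map size_subseqs szW size_filter => h.
  have := count_predC (mem bad) (iota 0 K); rewrite size_iota => hc.
  rewrite size_filter -(leq_add2l (2 ^ (size V + n ^ size J))) addnC.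
  apply: leq_trans hK _; rewrite -[leqLHS]hc; apply: leq_add => //.
pose h x := nth 0 ok x.
have hP x : x < n -> h x < K /\ h x \notin bad.
  move=> xn; have := mem_nth 0 (leq_trans xn nok).
  by rewrite mem_filter mem_iota add0n => /and3P[].
have hI x y : x < n -> y < n -> h x = h y -> x = y.
  move=> xn yn /eqP; rewrite nth_uniq ?(leq_trans _ nok)//; first by move/eqP.
  by rewrite filter_uniq// iota_uniq.
pose phi (z : nat -> nat) i' := if i' == i then h (z i') else z i'.
have phiK z : cube n z -> cube K (phi z).
  move=> zn i'; rewrite /phi; case: eqP => _; first by have [] := hP _ (zn i').
  exact: leq_trans nK.
exists phi; split=> // [a z z' zn zn'|s z sP zK Rz].
  split=> ag i' i'J ai'; have := ag i' i'J ai'; rewrite /phi; last by move->.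
  by case: eqP => // _; exact: hI.
have bra : brick1 ra J K e by apply: hb; rewrite inE eqxx.
have brb : brick1 rb J K e by apply: hb; rewrite !inE eqxx orbT.
have sW : {subset s <= W}.
  move=> x /sP; rewrite mem_cat => -[->//|[z' zn' ->]]; apply/orP; right.
  apply/mapP; exists (mkseq z' (size J)); first exact: mem_cubes.
  have [_ _ /(_ _ _)] := bra _ (phiK _ zn').
  move=> ->; last by apply: leq_cube nK _; apply: (@cube_nth_cubes (size J)) => //; exact: mem_cubes.
  move=> i' i'J ai'; rewrite /phi; case: eqP => [e'|_]; last by rewrite nth_mkseq.
  by case: nai; rewrite -e'.
pose v := [seq x <- W | x \in s].
have RvE : R v = R s := monotone_filter mR sW.
have [z0K Rz0] : cube K (z0 v) /\ R v (mp rb (e (z0 v))).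
  by apply: z0P; exists z => //; rewrite RvE.
exists (z0 v) => //; split=> [|z' zn' ee]; first by rewrite -RvE.
have [_ _ /(_ _ (phiK _ zn'))[/(_ ee) ag _]] := brb _ z0K.
have := ag i iJ bi; rewrite /phi eqxx => e'.
have [_ /negP] := hP _ (zn' i); apply; rewrite -e'.
by apply: (map_f (fun v => z0 v i)); exact: filter_subseqs.
Qed.
End Shrink.

Lemma eval_flatten b m n z : m < n -> eval (b m) z \in flatten (map vals (mkseq b n)).
Proof.
move=> mn; apply/flatten_mapP; exists (b m); last exact: eval_vals.
by apply: map_f; rewrite mem_iota.
Qed.

(** A sparse subsequence of bricks is kept, each thinned by [shrink]. Tameness drops the members of
    [s] from bricks after that of [k]; [shrink] then replaces [k] by a forced value removed from
    that brick. *)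
Lemma step_Tukey S ra rb R E : MA_sigma_centered -> small S -> good S ->
  S (restr setT) -> S ra -> S rb -> ~ idx rb `<=* idx ra ->
  monotone_rel R -> tame_rel R E -> good (addr S (restr (mp ra @^-1` E))) ->
  exists r, good (addr S r) /\ forall s k,
    (forall x, x \in s -> (mp ra @` dom r) x) -> (mp rb @` dom r) k -> R s k ->
    exists k', R s k' /\ ~ (mp rb @` dom r) k'.
Proof.
move=> MA smS gS S0 Sa Sb ba mR tR gE.
set rE := restr _ in gE; set S1 := addr S rE in gE.
have smS1 : small S1 by apply: small_setU => //; exact: small1.
have SS1 : S `<=` S1 by move=> x; left.
have [b bP] := good_fusion setT MA smS1 gE (SS1 _ S0).
have [|N0 N0P] := bP [:: ra; rb; restr setT].
  by move=> x; rewrite !inE => /or3P[] /eqP->; exact: SS1.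
have [|N1 N1P] := bP [:: rE]; first by move=> x; rewrite inE => /eqP->; right.
pose V n := flatten (map vals (mkseq b n)).
have /choice[G GP] : forall n, exists l, forall s k s', {subset s <= map (mp ra) (V n)} ->
    k \in map (mp rb) (V n) -> (forall x, x \in s' -> E x /\ l <= x) ->
    R (s ++ s') k -> R s k.
  by move=> n; exact: uniform_tame.
(* The gaps let all [mp ra]-values of later bricks exceed the tameness bound [G] for the values up
   to the current one. *)
pose nn := fix nn j := if j is j'.+1 then maxn (nn j').+1 (G (nn j').+1)
  else maxn 1 (maxn N0 N1).
have nnS j : nn j < nn j.+1 by exact: leq_maxl.
have nnG i j : i < j -> nn i < nn j /\ G (nn i).+1 <= nn j.
  elim: j => // j IH; rewrite ltnS leq_eqVlt => /orP[/eqP->|/IH[h1 h2]].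
    by split; [exact: nnS|exact: leq_maxr].
  by split; [exact: ltn_trans (nnS j)|apply: leq_trans h2 (ltnW (nnS j))].
have nn0 j : [/\ 0 < nn j, N0 <= nn j & N1 <= nn j].
  have [->|j0] := posnP j; first by rewrite /= !leq_max !leqnn !orbT.
  have [h _] := nnG _ _ j0.
  by split; apply: leq_trans (ltnW h); rewrite /= !leq_max !leqnn ?orbT.
have nnj j : j <= nn j by elim: j => // j IH; apply: leq_ltn_trans IH (nnS j).
have fN j : fused setT [:: ra; rb; restr setT] (mkseq b (nn j)) (b (nn j)).
  by have [_ h _] := nn0 j; exact: N0P.
have fE j : fused setT [:: rE] (mkseq b (nn j)) (b (nn j)).
  by have [_ _ h] := nn0 j; exact: N1P.
have /choice[phi phiP] := fun j => shrink mR (fN j) (let: And3 h _ _ := nn0 j in h) ba.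
pose el j z := eval (b (nn j)) (phi j z).
pose d : set nat := [set u | exists j z, cube (nn j) z /\ u = el j z].
exists (restr d); split.
  apply: good_addr => // F k FS.
  have [|N NP] := bP (restr setT :: F).
    by move=> x; rewrite inE => /orP[/eqP->|/FS]; exact: SS1.
  pose j := maxn k N; have kj : k <= nn j := leq_trans (leq_maxl _ _) (nnj j).
  have [h1 _ h3 _ _] := NP (nn j) (leq_trans (leq_maxr _ _) (nnj j)).
  rewrite size_mkseq in h3; have [p1 p2 _] := phiP j.
  have bphi : brick (restr setT :: F) (lab (b (nn j))) k (el j).
    apply: (brick_leq kj) => x xF.
    apply: (@brick1_comp _ _ _ _ (side (b (nn j))) _ (phi j)); last 2 first.
    - exact: p1.
    - by move=> z z'; exact: p2.
    - exact: (fused_side (fN j)).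
    - exact: h1.
  exists (lab (b (nn j))), (el j); split=> [x|].
    rewrite inE => /orP[/eqP->|xF]; last by apply: bphi; rewrite inE xF orbT.
    apply: brick1_restr; first by apply: bphi; rewrite inE eqxx.
    by move=> z zk; exists j, z; split=> //; exact: leq_cube zk.
  apply: rich_leq kj _; apply: sub_rich h3 => a; rewrite /= !inE => /orP[->//|->].
  by rewrite !orbT.
move=> s k sP [_ [j [z [zn ->]]] <-] Rk.
have [p1 p2 p3] := phiP j.
pose near x := x \in map (mp ra) (V (nn j)) \/
  exists2 z', cube (nn j) z' & x = mp ra (el j z').
pose s0 := [seq x <- s | `[< near x >]]; pose s1 := [seq x <- s | ~~ `[< near x >]].
have s1P x : x \in s1 -> E x /\ G (nn j).+1 <= x.
  rewrite mem_filter => /andP[/asboolPn nx /sP[_ [i [z' [zn' ->]]] xE]].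
  have [q1 _ _] := phiP i.
  have [ij|ij|ij] := ltngtP i j.
  - case: nx; left; rewrite -xE; apply: map_f; apply: eval_flatten.
    by have [] := nnG _ _ ij.
  - have [_ Gi] := nnG _ _ ij; rewrite -xE; split.
      have [h _ _ _ _] := fE i; have [] := h _ (mem_head _ _) _ (q1 _ zn').
      by [].
    have [h _ _ _ _] := fN i; have [_ h2 _] := h _ (mem_head _ _) _ (q1 _ zn').
    by apply: leq_trans h2; apply: leq_trans Gi (fused_side (fN i)).
  - by case: nx; right; subst i; exists z'.
have {}Rk : R s0 (mp rb (el j z)).
  apply: (GP (nn j).+1 _ _ s1) => //.
  - move=> x; rewrite mem_filter => /andP[/asboolP[xV|[z' _ ->]] _].
      move: xV => /mapP[u uV ->]; apply: map_f; move: uV.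
      rewrite /V /mkseq -addn1 iotaD add0n !map_cat flatten_cat mem_cat.
      by move->.
    by apply: map_f; exact: eval_flatten.
  - by apply: map_f; exact: eval_flatten.
  - apply: mR Rk => x xs; rewrite mem_cat !mem_filter xs !andbT.
    by case: (`[< near x >]).
have [|z0 z0K [Rz0 z0P]] := p3 s0 (phi j z) _ (p1 _ zn) Rk.
  by move=> x; rewrite mem_filter => /andP[/asboolP].
exists (mp rb (eval (b (nn j)) z0)); split.
  by apply: mR Rz0 => x; rewrite mem_filter => /andP[].
(* Separation keeps the new value out of every other brick. *)
move=> [_ [i [z' [zn' ->]]] e]; have [q1 _ _] := phiP i.
have rbL : rb \in [:: ra; rb; restr setT] by rewrite !inE eqxx orbT.
have [ij|ij|ij] := ltngtP i j.
- have [nij _] := nnG _ _ ij.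
  by have := fused_sep (phi i z') (fN j) nij rbL z0K; rewrite -e ltnn.
- have [nij _] := nnG _ _ ij.
  by have := fused_sep z0 (fN i) nij rbL (q1 _ zn'); rewrite -e ltnn.
- by subst i; exact: (z0P z').
Qed.

(** * Tukey reductions to P-points *)

Lemma decisive_ultrafilter (F : set_system nat) : ProperFilter F ->
  (forall A, F A \/ F (~` A)) -> UltraFilter F.
Proof.
move=> FF Fdec; split=> // G GF FG; apply/seteqP; split=> // A GA.
case: (Fdec A) => // /FG GnA; have /filter_ex[x []//] : G (A `&` ~` A) by exact: filterI.
Qed.

Lemma nonprincipal_set1 U n : nonprincipal_ultrafilter U -> ~ U [set n].
Proof.
move=> [UU Unp] Un; apply: (Unp n); apply/seteqP; split=> A.
  move=> UA; apply/principal_filterP.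
  by have /filter_ex[x [->]] : U ([set n] `&` A) by exact: filterI.
by move=> /principal_filterP An; apply: filterS Un => x ->.
Qed.

Lemma P_point_fmap U f : P_point U -> (forall n, ~ U (f @^-1` [set n])) ->
  P_point (fmap f U).
Proof.
move=> [[UU Unp] UP] fn; split.
  split.
    apply: decisive_ultrafilter => A.
    by have [h|h] := in_ultra_setVsetC (f @^-1` A) UU; [left|right].
  move=> n e; apply: (fn n); have : fmap f U [set n] by rewrite e.
  by [].
move=> h; have [X UX Xh] := UP (h \o f); exists (f @` X).
  suff : U (f @^-1` (f @` X)) by [].
  by apply: filterS UX => x Xx; exists x.
case: Xh => [fin|[c cP]]; [left=> n|right; exists c => _ [x Xx <-]; exact: cP].
apply: (@sub_finite_set _ _ (f @` (X `&` (h \o f) @^-1` [set n]))).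
  by move=> _ [[x Xx <-] /= hn]; exists x.
exact: finite_image.
Qed.

(** Apply the P-point property to the first index [f x] at which [x] leaves the decreasing sets
    [C m], capped at [x]. A constant value [m] on a set of [V] would put the singleton of [m] into
    [V]. *)
Lemma P_point_pseudo_intersection V (c : nat -> set nat) : P_point V ->
  (forall n, V (c n)) -> exists E, V E /\
    forall n, exists l, forall x, E x -> l <= x -> c n x.
Proof.
move=> [Vnp VP] Vc; have [VU _] := Vnp.
pose C n x := forall i, i <= n -> c i x.
have VC n : V (C n).
  elim: n => [|n IH]; first by apply: filterS (Vc 0) => x cx [].
  have : V (C n `&` c n.+1) by exact: filterI.
  apply: filterS => x [Cx cx] i; rewrite leq_eqVlt => /orP[/eqP->//|]; exact: Cx.
have /choice[f fP] : forall x, exists m, (m = x \/ ~ C m x) /\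
    forall i, i < m -> C i x.
  move=> x; have ex : exists m, `[< m = x \/ ~ C m x >] by exists x; apply/asboolP; left.
  exists (ex_minn ex); case: ex_minnP => m /asboolP mP mmin; split=> // i im.
  apply: contrapT => nC; have : m <= i by apply: mmin; apply/asboolP; right.
  by rewrite leqNgt im.
have [E VE EP] := VP f; exists E; split=> // n.
case: EP => [fin|[m mP]].
  have [M MP] : exists M, forall i, i <= n -> forall x, E x -> f x = i -> x < M.
    elim: n => [|n [M MP]].
      have /finite_set_natP[M MP] := fin 0; exists M => -[]// _ x Ex fx; exact: MP.
    have /finite_set_natP[M' MP'] := fin n.+1.
    exists (maxn M M') => i; rewrite leq_eqVlt => /orP[/eqP->|im] x Ex fx; rewrite leq_max.
      by rewrite MP' ?orbT.
    by rewrite (MP i).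
  exists M => x Ex Mx; have [_ h] := fP x.
  have nf : n < f x.
    by rewrite ltnNge; apply/negP => fn; have := MP _ fn x Ex erefl; rewrite ltnNge Mx.
  exact: (h n nf n).
have Vm : V [set m].
  have : V (E `&` C m) by exact: filterI.
  by apply: filterS => x [/mP fx Cx]; have [[]] := fP x; rewrite fx.
by case: (nonprincipal_set1 Vnp Vm).
Qed.

(** [phi v] is the union of all [g v'] with [v'] in [V] below [v]. If no [v] worked for [u], the
    sets whose [g]-image is not inside [u] would be cofinal, against convergence of [g]. *)
Lemma Tukey_monotone U V : UltraFilter U -> UltraFilter V -> Tukey_le U V ->
  exists phi : set nat -> set nat,
   [/\ forall v v', v `<=` v' -> phi v `<=` phi v', forall v, V v -> U (phi v) &
       forall u, U u -> exists v, V v /\ phi v `<=` u].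
Proof.
move=> UU VU [g [gU gcof]].
have conv u : U u -> exists v, V v /\ forall v', V v' -> v' `<=` v -> g v' `<=` u.
  move=> Uu; apply: contrapT => h.
  have [|_ /(_ u Uu)[_ [v [Vv nv] <-] //]] := gcof [set v | V v /\ ~ g v `<=` u].
  split=> [v []//|v Vv]; apply: contrapT => h'; apply: h; exists v; split=> // v' Vv' v'v.
  by apply: contrapT => h''; apply: h'; exists v'.
exists (fun v => [set k | exists v', [/\ V v', v' `<=` v & g v' k]]); split.
- move=> v v' vv' k [w [Vw wv gw]]; exists w; split=> //; exact: subset_trans vv'.
- by move=> v Vv; apply: filterS (gU v Vv) => k gk; exists v; split=> // x.
- move=> u /conv[v [Vv vP]]; exists v; split=> // k [w [Vw wv gw]]; exact: (vP w).
Qed.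

(* [R s] collects the points common to all [phi c] with [c] in [V] containing [s].
   If [R] missed [d] on all finite subsets of [e], an element of [V] omitting
   infinitely many blocks of a fast growing partition would lie below the infinitely
   many witnesses [C n], so that its image under [phi] would be disjoint from [d]. *)
Lemma Tukey_finite_support U V : P_point V -> UltraFilter U -> Tukey_le U V ->
  exists R E, [/\ monotone_rel R, tame_rel R E, V E,
    forall e d, V e -> U d -> exists s k, [/\ forall x, x \in s -> e x, d k & R s k] &
    forall d, U d -> exists e, V e /\ forall s, (forall x, x \in s -> e x) -> R s `<=` d].
Proof.
move=> VP UU UV; have [[VU Vnp] _] := VP.
have [phi [mphi Uphi cphi]] := Tukey_monotone UU VU UV.
pose R (s : seq nat) := [set k | forall c, V c -> (forall x, x \in s -> c x) -> phi c k].
have nR s k : ~ R s k -> exists c, [/\ V c, forall x, x \in s -> c x & ~ phi c k].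
  move=> h; apply: contrapT => h'; apply: h => c Vc cs; apply: contrapT => nk.
  by apply: h'; exists c.
(* One witness in [V] for each of the countably many failures of [R]; their pseudo-intersection [E]
   makes [R] tame. *)
have /choice[c cP] : forall sk : seq nat * nat, exists c, V c /\
    (~ R sk.1 sk.2 -> (forall x, x \in sk.1 -> c x) /\ ~ phi c sk.2).
  move=> [s k]; have [h|/nR[c [Vc cs ck]]] := pselect (R s k); last by exists c.
  exists setT; split; first exact: filterT.
  by move=> nR'; case: (nR' h).
have [E [VE EP]] : exists E, V E /\ forall sk, exists l, forall x, E x -> l <= x -> c sk x.
  have [|E [VE EP]] := @P_point_pseudo_intersection V
      (fun n => if unpickle n is Some sk then c sk else setT) VP.
    by move=> n; case: unpickle => [sk|]; [have [] := cP sk|exact: filterT].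
  by exists E; split=> // sk; have := EP (pickle sk); rewrite pickleK.
exists R, E; split=> //.
- by move=> s s' ss k Rk c' Vc' c's; apply: Rk => // x /ss; exact: c's.
- move=> s k; have [l lP] := EP (s, k); exists l => s' s'E Rk.
  apply: contrapT => nRk; have [Vc /(_ nRk)[/= cs]] := cP (s, k); apply; apply: Rk => // x.
  by rewrite mem_cat => /orP[/cs//|/s'E[]]; exact: lP.
- move=> e d Ve Ud; apply: contrapT => h.
  have nRe s k : (forall x, x \in s -> e x) -> d k -> ~ R s k.
    by move=> se dk Rk; apply: h; exists s, k.
  (* Finitely many witnesses are intersected, one for each [k < n] in [d], all containing [e] below
     [n]. *)
  have /choice[C CP] : forall n, exists C, [/\ V C, forall x, x < n -> e x -> C x &
      forall k, k < n -> d k -> ~ phi C k].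
    move=> n; suff [C CP] : exists C, [/\ V C, forall x, x < n -> e x -> C x &
      forall k, k < n -> d k -> ~ phi C k] by exists C.
    suff : forall m, exists C, [/\ V C, forall x, x < n -> e x -> C x &
      forall k, k < m -> d k -> ~ phi C k] by apply.
    elim=> [|m [C [VC Ce Cd]]]; first by exists setT; split=> //; exact: filterT.
    have [dm|ndm] := pselect (d m); last first.
      by exists C; split=> // k; rewrite ltnS leq_eqVlt => /orP[/eqP->//|]; exact: Cd.
    have [|C' [VC' C's C'm]] := @nR [seq x <- iota 0 n | `[< e x >]] m.
      by apply: nRe => // x; rewrite mem_filter => /andP[/asboolP].
    exists (C `&` C'); split; first exact: filterI.
      by move=> x xn ex; split; [exact: Ce|apply: C's; rewrite mem_filter mem_iota asboolT].
    move=> k; rewrite ltnS leq_eqVlt => /orP[/eqP->|km] dk hk.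
      by apply: C'm; apply: mphi hk => x [].
    by apply: (Cd k km dk); apply: mphi hk => x [].
  have [|E' [VE' /choice[l lP]]] := @P_point_pseudo_intersection V C VP.
    by move=> n; have [] := CP n.
  (* Beyond the block that starts at [p i], the set [E'] is contained in [C (p i)]. *)
  pose p := fix p i := if i is i'.+1 then maxn (p i').+1 (l (p i')) else 0.
  have pS i : p i < p i.+1 by exact: leq_maxl.
  have pl i : l (p i) <= p i.+1 by exact: leq_maxr.
  have pmono i j : i <= j -> p i <= p j.
    elim: j => [|j IH]; first by rewrite leqn0 => /eqP->.
    by rewrite leq_eqVlt => /orP[/eqP->//|/IH h']; apply: leq_trans h' (ltnW (pS j)).
  have pge i : i <= p i by elim: i => // i IH; apply: leq_ltn_trans IH (pS i).
  have [A [VA AP]] : exists A, V A /\ forall m, exists i, m <= i /\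
      forall x, A x -> p i <= x -> p i.+1 <= x.
    (* [V] contains the union of the even blocks or its complement; either one omits infinitely many
       blocks. *)
    pose Ev x := exists i, ~~ odd i /\ p i <= x < p i.+1.
    have [h'|h'] := in_ultra_setVsetC Ev VU.
      exists Ev; split=> // m; exists m.*2.+1; split; first lia.
      move=> x [i [ei /andP[ix xi]]] mx; rewrite leqNgt; apply/negP => xm.
      have [im|im|im] := ltngtP i m.*2.+1.
      - by have := leq_trans (pmono _ _ im) mx; rewrite leqNgt xi.
      - by have := leq_trans (pmono _ _ im) ix; rewrite leqNgt xm.
      - by move: ei; rewrite im /= odd_double.
    exists (~` Ev); split=> // m; exists m.*2; split; first lia.
    move=> x nx mx; rewrite leqNgt; apply/negP => xm; apply: nx.
    by exists m.*2; rewrite odd_double mx.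
  pose w := e `&` E' `&` A.
  have Vw : V w by do 2 apply: filterI => //.
  have wC m : exists i, m <= i /\ w `<=` C (p i).
    have [i [mi iP]] := AP m; exists i; split=> // x [[ex E'x] Ax].
    have [VC Ce _] := CP (p i); have [xp|xp] := ltnP x (p i); first exact: Ce.
    by apply: lP => //; apply: leq_trans (pl i) (iP x Ax xp).
  have /filter_ex[k [hk dk]] : U (phi w `&` d) by apply: filterI => //; exact: Uphi.
  have [i [ki wi]] := wC k.+1; have [_ _ /(_ k _ dk)] := CP (p i).
  by apply; [apply: leq_trans ki (pge i)|exact: mphi wi _ hk].
- move=> d /cphi[e [Ve ed]]; exists e; split=> // s se k Rk; apply: ed; exact: Rk.
Qed.

(** * The transfinite recursion *)

(* A tag and the parameters of a task; unused components serve to repeat a task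
   continuum often, so that it recurs after the requirements it refers to. *)
Definition task := (nat * (nat -> nat -> nat) * (nat -> set nat) * (seq nat -> set nat))%type.

(** Adding [d] prevents [R] from governing a cofinal map from the [f]-image to the [g]-image of the
    ultrafilter: points forced by finite sets cannot be confined to the [g]-image of [d]. *)
Definition defeats (R : seq nat -> set nat) (f g : nat -> nat) (d : set nat) :=
  forall s k, (forall x, x \in s -> (f @` d) x) -> (g @` d) k -> R s k ->
    exists k', R s k' /\ ~ (g @` d) k'.

(** Tag 0 decides a set, 1 serves the P-point property, 2 adds an index set, and the others defeat a
    possible Tukey reduction. *)
Definition meets (S : set req) (t : task) (r : req) :=
  let: (i, f, x, R) := t in
  match i with
  | 0 => dom r `<=` x 0 \/ dom r `<=` ~` x 0
  | 1 => (forall m, finite_set (dom r `&` f 0 @^-1` [set m])) \/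
         exists c, forall u, dom r u -> f 0 u = c
  | 2 => idx r = x 0 /\ RK_coherent S r
  | _ => forall ra rb, S ra -> S rb -> mp ra = f 0 -> mp rb = f 1 ->
      ~ idx rb `<=* idx ra -> monotone_rel R -> tame_rel R (x 0) ->
      good (addr S (restr (mp ra @^-1` x 0))) -> defeats R (mp ra) (mp rb) (dom r)
  end.

Lemma exists_meets S t : MA_sigma_centered -> small S -> good S -> S (restr setT) ->
  exists r, good (addr S r) /\ meets S t r.
Proof.
move=> MA smS gS S0; case: t => [[[[|[|[|i]]] f] x] R].
- by have [r [gr h]] := step_decide (x 0) gS S0; exists r.
- by have [r [gr h]] := step_P_point (f 0) MA smS gS S0; exists r.
- by have [r [h1 h2 h3]] := step_index (x 0) MA smS gS S0; exists r.
pose P ra rb := [/\ S ra, S rb, mp ra = f 0 & mp rb = f 1] /\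
  [/\ ~ idx rb `<=* idx ra, monotone_rel R, tame_rel R (x 0) &
      good (addr S (restr (mp ra @^-1` x 0)))].
have [[ra [rb [[h1 h2 h3 h4] [h5 h6 h7 h8]]]]|nP] := pselect (exists ra rb, P ra rb).
  have [r [gr rP]] := step_Tukey MA smS gS S0 h1 h2 h5 h6 h7 h8.
  by exists r; split=> // ra' rb' _ _ ea eb _ _ _ _; rewrite ea eb -h3 -h4.
exists (restr setT); split; first by apply: sub_good gS => y [//|->].
by move=> ra rb *; case: nP; exists ra, rb.
Qed.

Lemma card_task : [set: task] #<= [set: set nat].
Proof.
pose enc (t : task) : set nat := fun n =>
  let: (i, f, x, R) := t in
  match (unpickle n : option (nat * seq nat * nat)) with
  | Some (0, _, k) => i = k
  | Some (1, s, k) => f (nth 0 s 0) (nth 0 s 1) = k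
  | Some (2, s, k) => x (nth 0 s 0) k
  | Some (_, s, k) => R s k
  | None => False
  end.
apply: (@card_le_inj _ _ _ _ enc) => // -[[[i f] x] R] [[[i' f'] x'] R'] _ _ e.
have E (p : nat * seq nat * nat) := congr1 (fun X : set nat => X (pickle p)) e.
have ei : i = i' by have := E (0, [::], i'); rewrite /enc !pickleK => ->.
have ef : f = f'.
  apply/funext => a; apply/funext => c.
  by have := E (1, [:: a; c], f' a c); rewrite /enc !pickleK => ->.
have ex : x = x'.
  apply/funext => a; apply/funext => c.
  by have := E (2, [:: a], c); rewrite /enc !pickleK.
have eR : R = R'.
  apply/funext => a; apply/funext => c.
  by have := E (3, a, c); rewrite /enc !pickleK.
by rewrite ei ef ex eR.
Qed.

Lemma wf_recursion (W T : Type) (lt : W -> W -> Prop) (step : set T -> W -> T) :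
  well_founded lt -> exists G : W -> T, forall w, G w = step (G @` [set v | lt v w]) w.
Proof.
move=> wf.
pose F w (rec : forall v, lt v w -> T) := step [set r | exists v (h : lt v w), rec v h = r] w.
exists (Fix wf (fun=> T) F) => w; rewrite Fix_eq.
  congr step; apply/seteqP; split=> r; first by move=> [v [h <-]]; exists v.
  by move=> [v h <-]; exists v, h.
move=> x f g fg; congr step; apply/seteqP; split=> r [v [h <-]]; exists v, h => //.
Qed.

Lemma small_segment (lt : task -> task -> Prop) w :
  ~ ([set: task] #<= [set v | lt v w]) -> small [set v | lt v w].
Proof.
move=> h; split; last by move=> h'; apply: h; exact: card_le_trans card_task h'.
by apply: card_le_trans card_task; exact: card_leT.
Qed.

(** Recursion along a well-order of the tasks with small initial segments; [exists_meets] supplies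
    the value at each task. *)
Lemma generic_family : MA_sigma_centered -> exists (S : set req) (pick : set nat -> req),
  [/\ good S, S (restr setT) &
      forall X, exists2 r, S r & dom r `<=` X \/ dom r `<=` ~` X] /\
  [/\ forall h : nat -> nat, exists2 r, S r &
        (forall m, finite_set (dom r `&` h @^-1` [set m])) \/
        exists c, forall u, dom r u -> h u = c,
      forall c, S (pick c) /\ idx (pick c) = c,
      forall c c', c `<=* c' -> exists r N, S r /\
        factors (dom r `&` [set u | N <= u]) (mp (pick c)) (mp (pick c')) &
      forall ra rb R E, S ra -> S rb -> ~ idx rb `<=* idx ra -> monotone_rel R ->
        tame_rel R E -> good (addr S (restr (mp ra @^-1` E))) ->
        exists2 r, S r & defeats R (mp ra) (mp rb) (dom r)].
Proof.
move=> MA; have [lt [wf tot tr seg]] := small_well_order task.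
pose base (A : set req) := [set restr setT] `|` A.
have /choice[st stP] : forall p : set req * task, exists r,
    (exists r, good (addr (base p.1) r) /\ meets (base p.1) p.2 r) ->
    good (addr (base p.1) r) /\ meets (base p.1) p.2 r.
  move=> p; have [[r rP]|h] := pselect (exists r, good (addr (base p.1) r) /\ meets (base p.1) p.2 r).
    by exists r.
  by exists (restr setT).
have [G GE] := wf_recursion (fun A t => st (A, t)) wf.
pose Sg (D : set task) := base (G @` D).
pose below w := [set v | lt v w].
(* Goodness concerns finite lists and the stages increase, so a list is contained in the stage of
   its latest task. *)
have good_Sg (D : set task) : (forall v, D v -> good (addr (Sg (below v)) (G v))) -> good (Sg D).
  move=> DP F FS.
  have [F0|[v Dv Fv]] : subreq F [set restr setT] \/
      exists2 v, D v & subreq F (addr (Sg (below v)) (G v)).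
    elim: F FS => [|r F IH] FS; first by left.
    have {}IH := IH (fun x xF => FS x (@mem_behead _ (r :: F) x xF)).
    have mono v w : lt v w -> addr (Sg (below v)) (G v) `<=` addr (Sg (below w)) (G w).
      move=> vw x [[->|[u uv <-]]|->]; left; [by left|right|by right; exists v].
      by exists u => //; exact: tr vw.
    have top v : addr (Sg (below v)) (G v) (restr setT) by left; left.
    case: (FS r (mem_head _ _)) => [r0|[v Dv vr]].
      case: IH => [F0|[w Dw Fw]]; [left|right; exists w => //] => x.
        by rewrite inE => /orP[/eqP->|/F0].
      by rewrite inE => /orP[/eqP->|/Fw//]; rewrite r0.
    right; case: IH => [F0|[w Dw Fw]].
      by exists v => // x; rewrite inE => /orP[/eqP->|/F0->]; [right|].
    case: (tot v w) => vw.
    - exists w => // x; rewrite inE => /orP[/eqP->|/Fw//].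
      by apply: (mono _ _ vw); right.
    - by subst w; exists v => // x; rewrite inE => /orP[/eqP->|/Fw//]; right.
    - exists v => // x; rewrite inE => /orP[/eqP->|/Fw]; first by right.
      exact: mono.
  - exact: good_base F0.
  - exact: DP Fv.
have GP w : good (addr (Sg (below w)) (G w)) /\ meets (Sg (below w)) w (G w).
  elim: {w}(wf w) => w _ IH.
  rewrite GE; apply: (stP (G @` below w, w)).
  apply: exists_meets => //; last by left.
    apply: small_setU; first exact: small1.
    by apply: small_image; exact: small_segment.
  by apply: good_Sg => v vw; have [] := IH v vw.
pose S := Sg setT.
have SG w : S (G w) by right; exists w.
have S0 : S (restr setT) by left.
have SgS w : Sg (below w) `<=` S by move=> x [->//|[v _ <-]].
have late r : S r -> small [set w | ~ Sg (below w) r].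
  move=> [->|[v _ <-]].
    apply: small_le (small1 0); apply: (@card_le_inj _ _ _ _ (fun=> 0)) => // x y.
    by move=> h; case: h; left.
  apply: small_le (small_setU (small1 v) (small_segment (seg v))).
  apply: subset_card_le => w nw; case: (tot v w) => vw; [|by left|by right].
  by case: nw; right; exists v.
pose tpick c : task := (2, fun=> id, fun=> c, fun=> set0).
exists S, (fun c => G (tpick c)); split; first split=> //.
- by apply: good_Sg => v _; have [] := GP v.
- by move=> X; have [_ h] := GP (0, fun=> id, fun=> X, fun=> set0); exists (G (0, fun=> id, fun=> X, fun=> set0)).
split.
- by move=> h; have [_ hP] := GP (1, fun=> h, fun=> set0, fun=> set0); exists (G (1, fun=> h, fun=> set0, fun=> set0)).
- by move=> c; split=> //; have [_ []] := GP (tpick c).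
- move=> c c' cc'.
  have [_ [ic coh]] := GP (tpick c); have [_ [ic' coh']] := GP (tpick c').
  case: (tot (tpick c) (tpick c')) => vw.
  + have [|N [h _]] := coh' (G (tpick c)); first by right; exists (tpick c).
    by exists (G (tpick c')), N; split=> //; apply: h; rewrite ic ic'.
  + by exists (restr setT), 0; split=> //; rewrite vw => u v _ _.
  + have [|N [_ h]] := coh (G (tpick c')); first by right; exists (tpick c').
    by exists (G (tpick c)), N; split=> //; apply: h; rewrite ic ic'.
move=> ra rb R E Sa Sb ba mR tR gE.
pose w y : task := (3, fun i => if i == 0 then mp ra else mp rb,
                    fun i => if i == 0 then E else y, R).
(* Continuum many tasks [w y] ask the same question, while [ra] and [rb] are missing at a small set
   of stages only. *)
have [y [ya yb]] : exists y, Sg (below (w y)) ra /\ Sg (below (w y)) rb.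
  apply: contrapT => h.
  have [_] := small_setU (late _ Sa) (late _ Sb); apply.
  apply: (@card_le_inj _ _ _ _ w) => [y _|y y' _ _].
    have [ya|] := pselect (Sg (below (w y)) ra); last by left.
    by right=> yb; apply: h; exists y.
  by move=> [/(congr1 (fun f => f 1))].
have [_ hm] := GP (w y); exists (G (w y)) => //; apply: hm => //.
exact: good_addr_sub gE.
Qed.

(** * The ultrafilters *)

Definition generated (S : set req) : set_system nat := [set X | exists2 r, S r & dom r `<=` X].

Section Generated.
Variable S : set req.
Hypothesis gS : good S.
Hypothesis S0 : S (restr setT).
Hypothesis Sdec : forall X, exists2 r, S r & dom r `<=` X \/ dom r `<=` ~` X.

Let U := generated S.

Lemma good_point F k : subreq F S -> exists u, forall r, r \in F -> dom r u /\ k <= mp r u.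
Proof.
(* The cube over no labels; the side [k.+1] is positive, so the zero point belongs to it. *)
move=> FS; have [//|e be] := gS FS (J := [::]) _ k.+1.
exists (e (fun=> 0)) => r rF; have [h1 h2 _] := be r rF (fun=> 0) (fun=> isT).
by split=> //; exact: ltnW.
Qed.

Lemma generated_dec X : U X \/ U (~` X).
Proof. by have [r Sr [h|h]] := Sdec X; [left|right]; exists r. Qed.

Lemma generated_meet X Y : U X -> U Y -> (X `&` Y) !=set0.
Proof.
move=> [r Sr rX] [r' Sr' rY]; have [|u uP] := @good_point [:: r; r'] 0.
  by move=> x; rewrite !inE => /orP[]/eqP->.
exists u; split; [apply: rX|apply: rY].
  by have [] := uP r (mem_head _ _).
by have [] := uP r'; rewrite // !inE eqxx orbT.
Qed.

Lemma generatedS X Y : X `<=` Y -> U X -> U Y.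
Proof. by move=> XY [r Sr rX]; exists r => //; exact: subset_trans XY. Qed.

Lemma generated_ultra : UltraFilter U.
Proof.
have UT : U setT by exists (restr setT).
have UF : Filter U.
  split=> // [X Y UX UY|X Y XY]; last exact: generatedS.
  case: (generated_dec (X `&` Y)) => // [[r Sr rXY]].
  have [|u uP] := @good_point [:: r] 0; first by move=> x; rewrite inE => /eqP->.
  have [rX SrX hX] := UX; have [rY SrY hY] := UY.
  have [|v vP] := @good_point [:: r; rX; rY] 0.
    by move=> x; rewrite !inE => /or3P[] /eqP->.
  case: (rXY v); first by have [] := vP r (mem_head _ _).
  split; [apply: hX; have [] := vP rX|apply: hY; have [] := vP rY] => //;
    by rewrite !inE eqxx ?orbT.
have UP : ProperFilter U.
  by split=> // U0; have [x []] := generated_meet U0 U0.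
exact: decisive_ultrafilter generated_dec.
Qed.

(** Otherwise [mp r] would stay below [N] on some [dom r'], while a brick for [r] and [r'] has a
    point of [dom r'] where it is at least [N]. *)
Lemma generated_ge r N : S r -> U [set u | N <= mp r u].
Proof.
move=> Sr; case: (generated_dec [set u | N <= mp r u]) => // -[r' Sr' r'N].
have [|u uP] := @good_point [:: r; r'] N; first by move=> x; rewrite !inE => /orP[]/eqP->.
have [_ Nu] := uP r (mem_head _ _).
by case: (r'N u) => //; have [] := uP r'; rewrite // !inE eqxx orbT.
Qed.

Lemma generated_fiber r n : S r -> ~ U (mp r @^-1` [set n]).
Proof.
move=> Sr h; have [u [/= -> ]] := generated_meet h (generated_ge n.+1 Sr).
by rewrite /= ltnn.
Qed.

Lemma generated_P_point :
  (forall h : nat -> nat, exists2 r, S r &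
    (forall m, finite_set (dom r `&` h @^-1` [set m])) \/
    exists c, forall u, dom r u -> h u = c) -> P_point U.
Proof.
move=> Spp; split; last by move=> h; have [r Sr hr] := Spp h; exists (dom r) => //; exists r.
split; first exact: generated_ultra.
move=> n e; apply: (@generated_fiber (restr setT) n) => //.
by rewrite -/U e; apply/principal_filterP.
Qed.

End Generated.

Lemma RK_le_factors V X f g : UltraFilter V -> V X -> factors X f g ->
  RK_le (fmap f V) (fmap g V).
Proof.
move=> VU VX fg.
have /choice[h hP] : forall y, exists m, forall u, X u -> g u = y -> f u = m.
  move=> y; have [[u [Xu <-]]|nu] := pselect (exists u, X u /\ g u = y).
    by exists (f u) => v Xv gv; exact: fg.
  by exists 0 => u Xu gu; case: nu; exists u.
exists h => A; rewrite /fmap /=.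
have E u : X u -> f u = h (g u) by move=> Xu; exact: hP.
split=> VA.
  have : V (f @^-1` A `&` X) by exact: filterI.
  by apply: filterS => u [/= Af Xu]; rewrite -E.
have : V (g @^-1` (h @^-1` A) `&` X) by exact: filterI.
by apply: filterS => u [/= Af Xu]; rewrite E.
Qed.

Lemma almost_subset_repr a : let c := repr (\pi_pomega_mod_fin a) in c `<=* a /\ a `<=* c.
Proof.
have : \pi_pomega_mod_fin (repr (\pi_pomega_mod_fin a)) = \pi_pomega_mod_fin a by rewrite reprK.
by move=> /eqmodP/asboolP.
Qed.

Theorem mainTheorem1 : MA_sigma_centered ->
  exists U : pomega_mod_fin -> set_system nat,
    (forall x, P_point (U x)) /\
    (forall a b : set nat, a `<=* b ->
       RK_le (U (\pi_pomega_mod_fin a)) (U (\pi_pomega_mod_fin b))) /\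
    (forall a b : set nat, ~ b `<=* a ->
       ~ Tukey_le (U (\pi_pomega_mod_fin b)) (U (\pi_pomega_mod_fin a))).
Proof.
move=> /generic_family[S [pick [[gS S0 Sdec] [Spp Spick SRK STk]]]].
have UU := generated_ultra gS S0 Sdec.
have UP (x : pomega_mod_fin) : P_point (fmap (mp (pick (repr x))) (generated S)).
  apply: P_point_fmap; first exact: generated_P_point.
  by move=> n; apply: generated_fiber => //; have [] := Spick (repr x).
exists (fun x : pomega_mod_fin => fmap (mp (pick (repr x))) (generated S)).
split=> //; split=> a b.
  move=> ab; have [ca ac] := almost_subset_repr a; have [cb bc] := almost_subset_repr b.
  have [|r [N [Sr rf]]] := SRK (repr (\pi_pomega_mod_fin a)) (repr (\pi_pomega_mod_fin b)).
    exact: almost_subset_trans (almost_subset_trans ca ab) bc.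
  apply: RK_le_factors rf; apply: filterI; first by exists r.
  (* The map of [restr setT] is the identity, so this is the tail from [N] on. *)
  exact: (generated_ge gS Sdec N S0).
move=> nba; have [ca ac] := almost_subset_repr a; have [cb bc] := almost_subset_repr b.
set ra := pick (repr (\pi_pomega_mod_fin a)); set rb := pick (repr (\pi_pomega_mod_fin b)).
have [Sa ia] : S ra /\ _ := Spick _; have [Sb ib] : S rb /\ _ := Spick _.
have [Ua' _] := (UP (\pi_pomega_mod_fin b)).1.
move=> /(Tukey_finite_support (UP (\pi_pomega_mod_fin a)) Ua')[R [E [mR tR VE VR Vcof]]].
have [||rE SE hE] := STk ra rb R E Sa Sb _ mR tR.
- by rewrite ia ib => h; apply: nba; apply: almost_subset_trans (almost_subset_trans bc h) ca.
- by case: VE => r Sr rE; exact: good_dom rE.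
have Ub : generated S (mp rb @^-1` (mp rb @` dom rE)) by exists rE => // u; exists u.
have Ua : generated S (mp ra @^-1` (mp ra @` dom rE)) by exists rE => // u; exists u.
(* Lists from [e] force only points of the [mp rb]-image of [dom rE], whereas [hE] turns a forced
   point of that image into one outside it. *)
have [e [Ve eP]] := Vcof _ Ub.
have [||s [k [sP dk Rk]]] := VR (e `&` (mp ra @` dom rE)) (mp rb @` dom rE).
- by apply: filterI.
- exact: Ub.
have [|k' [Rk' nk']] := hE s k _ dk Rk; first by move=> x /sP[].
by apply: nk'; apply: (eP s) => // x /sP[].
Qed.
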